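(* There exists $a>0$ such that for every $c\in\mathbb{C}$ with $0\le |c|<a$, the set $\mathcal{K}_c=\{z\in\mathbb{C} : (z,z)\in K_c^+\}$ (that is, $K_c^+\cap\Delta$, where $\Delta=\{(z,z): z\in\mathbb{C}\}$ is the diagonal, identified with $\mathbb{C}$) is a quasi-disk. Moreover the map $c\mapsto\mathcal{K}_c$, for $|c|<a$, is continuous for the Hausdorff topology on non-empty compact subsets of $\mathbb{C}$.
   Context: For $c\in\mathbb{C}$ let $H_c:\mathbb{C}^2\to\mathbb{C}^2$, $H_c(x,y)=(xy+c,x)$, and let $K_c^+=\{(x,y)\in\mathbb{C}^2 : (H_c^{n}(x,y))_{n\ge 0}\text{ is bounded}\}$, where $H_c^n$ is the $n$-th iterate. Equivalently, with $f_0(z)=f_1(z)=z$ and $f_n(z)=f_{n-1}(z)f_{n-2}(z)+c$ for $n\ge 2$, $\mathcal{K}_c=\{z\in\mathbb{C}:\sup_n|f_n(z)|<\infty\}$. A (closed) quasi-disk is the image of the closed unit disk under a quasiconformal homeomorphism of the Riemann sphere, contained in $\mathbb{C}$. *)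

(* Defs.v *)
From HB Require Import structures.
From mathcomp Require Import all_boot all_order all_algebra.
From mathcomp Require Import complex.
From mathcomp Require Import all_classical all_reals all_analysis.

Set Implicit Arguments.
Unset Strict Implicit.
Unset Printing Implicit Defensive.

Import Order.TTheory GRing.Theory Num.Theory.
Import numFieldNormedType.Exports.
Import ComplexField.Normc.

Local Open Scope classical_set_scope.
Local Open Scope ring_scope.

(** [R[i]^o] is convertible to [R[i]] and is the copy that carries the normed
    space structure. Its library norm takes values in [R[i]] itself, so
    real-valued moduli are written with [normc]. *)
Notation Cplx R := (R[i]^o).

Definition henon (R : realType) (c : Cplx R) (p : Cplx R * Cplx R) :
    Cplx R * Cplx R :=
  (p.1 * p.2 + c, p.1).

Definition Kplus (R : realType) (c : Cplx R) : set (Cplx R * Cplx R) :=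
  [set p | bounded_set (range (fun n : nat => iter n (henon c) p))].

Definition Kdiag (R : realType) (c : Cplx R) : set (Cplx R) :=
  [set z | Kplus c (z, z)].

(** The Riemann sphere: [None] is the point at infinity. *)
Notation sphere R := (one_point_compactification (Cplx R)).

(** Under stereographic projection this is the Euclidean distance of the unit
    sphere of R^3; it is a conformal metric inducing the topology. *)
Definition chordal (R : realType) (p q : sphere R) : R :=
  match p, q with
  | Some z, Some w => 2 * normc (z - w) /
      (Num.sqrt (1 + normc z ^+ 2) * Num.sqrt (1 + normc w ^+ 2))
  | Some z, None | None, Some z => 2 / Num.sqrt (1 + normc z ^+ 2)
  | None, None => 0
  end.

Definition homeomorphism (T U : topologicalType) (f : T -> U) : Prop :=
  continuous f /\
  exists g : U -> T, [/\ cancel f g, cancel g f & continuous g].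

(** Metric definition of quasiconformality: the linear dilatation
      limsup_(r -> 0+) sup_(d(p,q) <= r) d(f p, f q)
                     / inf_(d(p,q) >= r) d(f p, f q)
    is bounded uniformly in p. For a homeomorphism f and small r the infimum is
    positive, so that the real quotient is meaningful. *)
Definition outer_radius (R : realType) (f : sphere R -> sphere R)
    (p : sphere R) (r : R) : R :=
  sup [set chordal (f p) (f q) | q in [set q | chordal p q <= r]].

Definition inner_radius (R : realType) (f : sphere R -> sphere R)
    (p : sphere R) (r : R) : R :=
  inf [set chordal (f p) (f q) | q in [set q | r <= chordal p q]].

Definition linear_dilatation (R : realType) (f : sphere R -> sphere R)
    (p : sphere R) : \bar R :=
  limf_esup (fun r : R => (outer_radius f p r / inner_radius f p r)%:E) 0^'+.

Definition quasiconformal (R : realType) (f : sphere R -> sphere R) : Prop :=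
  homeomorphism f /\
  exists H : R, forall p, (linear_dilatation f p <= H%:E)%E.

(** As [Some] embeds the plane in the sphere, the equality below also says that
    the image of the disk avoids infinity. *)
Definition quasi_disk (R : realType) (K : set (Cplx R)) : Prop :=
  exists f : sphere R -> sphere R, quasiconformal f /\
    f @` [set Some z | z in [set z : Cplx R | normc z <= 1]] =
    [set Some z | z in K].

Definition hausdorff_excess (R : realType) (A B : set (Cplx R)) : R :=
  sup [set inf [set normc (x - y) | y in B] | x in A].

Definition hausdorff_dist (R : realType) (A B : set (Cplx R)) : R :=
  Num.max (hausdorff_excess A B) (hausdorff_excess B A).

(** [F] is a continuous map from [D] to the non-empty compact subsets of the
    plane. Requiring the values to be such sets keeps [sup] and [inf] in
    [hausdorff_dist] from taking their default value 0. *)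
Definition hausdorff_continuous_on (R : realType) (D : set (Cplx R))
    (F : Cplx R -> set (Cplx R)) : Prop :=
  (forall c, D c -> F c !=set0 /\ compact (F c)) /\
  (forall c, D c ->
     hausdorff_dist (F x) (F c) @[x --> within D (nbhs c)] --> (0 : R)).

(* Main.v *)
(** In the coordinate z = e^w the sequence f_n becomes g_n = s + log (1 + c e^(-s))
    with s = g_(n-1) + g_(n-2): a perturbed Fibonacci recursion. As only the part
    |Re s| <= 1 of an orbit decides whether it is bounded, the perturbation may
    be cut off for |Re s| >= 2; it is then small, Lipschitz and, outside two
    strips that an orbit crosses in at most six steps, conformal. By the
    hyperbolicity of the Fibonacci recursion every orbit (g_n) from w has a
    unique y with g_n - F_n y bounded, and w |-> y is a bijection commuting with
    the periods of exp. Hence K_c is the image of the closed disk under the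
    map f induced on the plane by the inverse y |-> w. Along the orbits of
    nearby points distances grow geometrically and, by conformality, with
    bounded distortion, up to a scale where g_n is F_n y up to a small error;
    this makes f quasisymmetric. Comparing two orbits with the same y for
    different parameters shows that f is Lipschitz in c. *)

Require Import Defs.
From HB Require Import structures.
From mathcomp Require Import all_boot all_order all_algebra.
From mathcomp Require Import complex.
From mathcomp Require Import all_classical all_reals all_analysis.
From mathcomp Require Import ring lra zify.

Set Implicit Arguments.
Unset Strict Implicit.
Unset Printing Implicit Defensive.

Import Order.TTheory GRing.Theory Num.Theory.
Import numFieldNormedType.Exports.
Import ComplexField.Normc.

Local Open Scope classical_set_scope.
Local Open Scope ring_scope.
Local Open Scope complex_scope.

Local Notation Re := (@complex.Re _).
Local Notation Im := (@complex.Im _).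

(** * The complex modulus *)

(** The Lipschitz bound on the perturbation alone would not give quasisymmetry: each step could
    change the ratio of two differences by a factor 1 + O(delta), and the number of steps before
    they reach a fixed size is unbounded as the points come together. Where the perturbation is
    conformal, two differences taken from a common orbit share its derivative, and only an error of
    order delta times the current distance remains. These errors sum geometrically; the full cost
    delta is paid only in the strips. The recursion has order two, so differences do not evolve by
    multiplication. What saves the argument is that orbits start on the diagonal: a difference has
    equal first two entries, which puts its successive quotients in a fixed disk away from 0 and
    makes the ratio of two differences start with a zero increment, after which increments contract.
    All smallness is carried by one number delta: 1 / 8 suffices for shadowing, and 1 / 10000 leaves
    room in the numerical estimates for the distortion. *)

Lemma normc_ge0 (R : realType) (x : R[i]) : 0 <= normc x.
Proof. by case: x => a b; exact: sqrtr_ge0. Qed.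

Lemma normc_eq0 (R : realType) (x : R[i]) : (normc x == 0) = (x == 0).
Proof.
by apply/eqP/eqP => [/eq0_normc //|->]; rewrite normc0.
Qed.

Lemma normc_gt0 (R : realType) (x : R[i]) : (0 < normc x) = (x != 0).
Proof. by rewrite lt0r normc_ge0 andbT normc_eq0. Qed.

Lemma ler_normcD (R : realType) (x y : R[i]) :
  normc (x + y) <= normc x + normc y.
Proof. exact: le_normcD. Qed.

Lemma normcNE (R : realType) (x : R[i]) : normc (- x) = normc x.
Proof. by rewrite -mulN1r normcM; case: x => a b /=; rewrite oppr0 expr0n /= addr0 sqrrN expr1n sqrtr1 mul1r. Qed.

Lemma normcBC (R : realType) (x y : R[i]) : normc (x - y) = normc (y - x).
Proof. by rewrite -normcNE opprB. Qed.

Lemma ler_normcB (R : realType) (x y : R[i]) :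
  normc (x - y) <= normc x + normc y.
Proof. by rewrite -(normcNE y); exact: ler_normcD. Qed.

Lemma lerB_normc (R : realType) (x y : R[i]) :
  normc x - normc y <= normc (x - y).
Proof. by have := ler_normcD (x - y) y; rewrite subrK; lra. Qed.

Lemma lerB_normcD (R : realType) (x y : R[i]) :
  normc x - normc y <= normc (x + y).
Proof. by have := lerB_normc x (- y); rewrite opprK normcNE. Qed.

Lemma ler_distcD (R : realType) (z x y : R[i]) :
  normc (x - y) <= normc (x - z) + normc (z - y).
Proof. by have := ler_normcD (x - z) (z - y); rewrite addrA subrK. Qed.

Lemma normcX (R : realType) (x : R[i]) n : normc (x ^+ n) = normc x ^+ n.
Proof.
by elim: n => [|n IH]; rewrite ?expr0 ?normc1 // !exprS normcM IH.
Qed.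

Lemma normcR (R : realType) (x : R) : normc x%:C = `|x|.
Proof. by rewrite /= expr0n /= addr0 sqrtr_sqr. Qed.

Lemma normc_nat (R : realType) n : normc (n%:R : R[i]) = n%:R.
Proof. by rewrite -(rmorph_nat (real_complex R)) normcR ger0_norm. Qed.

Lemma ler_normRe (R : realType) (x : R[i]) : `|Re x| <= normc x.
Proof.
case: x => a b /=; rewrite -sqrtr_sqr ler_wsqrtr //.
by rewrite lerDl sqr_ge0.
Qed.

Lemma ler_normIm (R : realType) (x : R[i]) : `|Im x| <= normc x.
Proof.
case: x => a b /=; rewrite -sqrtr_sqr ler_wsqrtr //.
by rewrite lerDr sqr_ge0.
Qed.

Lemma normc_le_ReIm (R : realType) (x : R[i]) : normc x <= `|Re x| + `|Im x|.
Proof.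
case: x => a b /=; rewrite -[leRHS]ger0_norm ?addr_ge0 // -sqrtr_sqr.
rewrite ler_wsqrtr // sqrrD !real_normK ?num_real //.
by have := mulr_ge0 (normr_ge0 a) (normr_ge0 b); lra.
Qed.

Lemma ReD (R : realType) (x y : R[i]) : Re (x + y) = Re x + Re y.
Proof. by case: x y => [a b] [c d]. Qed.

Lemma ImD (R : realType) (x y : R[i]) : Im (x + y) = Im x + Im y.
Proof. by case: x y => [a b] [c d]. Qed.

Lemma ReN (R : realType) (x : R[i]) : Re (- x) = - Re x.
Proof. by case: x. Qed.

Lemma ImN (R : realType) (x : R[i]) : Im (- x) = - Im x.
Proof. by case: x. Qed.

Lemma ReB (R : realType) (x y : R[i]) : Re (x - y) = Re x - Re y.
Proof. by rewrite ReD ReN. Qed.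

Lemma ImB (R : realType) (x y : R[i]) : Im (x - y) = Im x - Im y.
Proof. by rewrite ImD ImN. Qed.

Lemma Re_natM (R : realType) n (x : R[i]) : Re (n%:R * x) = n%:R * Re x.
Proof.
by rewrite !mulr_natl; elim: n => [|n IH]; rewrite ?mulr0n // !mulrS ReD IH.
Qed.

(** * The complex exponential *)

Definition cexp (R : realType) (w : R[i]) : R[i] :=
  (expR (Re w) * cos (Im w)) +i* (expR (Re w) * sin (Im w)).

Lemma cexpD (R : realType) (x y : R[i]) : cexp (x + y) = cexp x * cexp y.
Proof.
rewrite /cexp ReD ImD expRD sinD cosD.
rewrite [RHS]/GRing.mul /=; congr (_ +i* _); ring.
Qed.

Lemma cexp0 (R : realType) : cexp 0 = 1 :> R[i].
Proof. by rewrite /cexp /= expR0 cos0 sin0 mulr0 mulr1. Qed.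

Lemma normc_cexp (R : realType) (x : R[i]) : normc (cexp x) = expR (Re x).
Proof.
rewrite /= !exprMn -mulrDr cos2Dsin2 mulr1 sqrtr_sqr.
by rewrite ger0_norm ?expR_ge0.
Qed.

Lemma cexp_neq0 (R : realType) (x : R[i]) : cexp x != 0.
Proof. by rewrite -normc_gt0 normc_cexp expR_gt0. Qed.

Lemma cexpN (R : realType) (x : R[i]) : cexp (- x) = (cexp x)^-1.
Proof.
apply: (mulfI (cexp_neq0 x)); rewrite -cexpD subrr cexp0 mulfV //.
exact: cexp_neq0.
Qed.

Lemma cexpB (R : realType) (x y : R[i]) : cexp (x - y) = cexp x / cexp y.
Proof. by rewrite cexpD cexpN. Qed.

Lemma cexp_surj (R : realType) (z : R[i]) : z != 0 -> exists w, cexp w = z.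
Proof.
move=> z0; have r0 : 0 < normc z by rewrite normc_gt0.
pose a := Re z / normc z.
have a1 : -1 <= a <= 1.
  have := ler_normRe z; rewrite ler_norml => /andP[h1 h2].
  by rewrite /a ler_pdivlMr // ler_pdivrMr // mulN1r mul1r h1 h2.
have b2 : 1 - a ^+ 2 = (Im z / normc z) ^+ 2.
  have : normc z ^+ 2 = Re z ^+ 2 + Im z ^+ 2.
    by case: (z) => u v /=; rewrite sqr_sqrtr // addr_ge0 ?sqr_ge0.
  move=> h; have hI : Im z ^+ 2 = normc z ^+ 2 - Re z ^+ 2 by lra.
  by rewrite /a expr_div_n [RHS]expr_div_n hI; field; rewrite gt_eqF.
have zE : z = (normc z * a) +i* (normc z * (Im z / normc z)).
  by rewrite /a !(mulrC (normc z)) !mulfVK ?gt_eqF //; case: (z).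
exists (ln (normc z) +i* (if 0 <= Im z then acos a else - acos a)).
rewrite /cexp /= lnK ?posrE //.
rewrite [RHS]zE; case: ifPn => [i0|]; last rewrite -ltNge => i0.
  by rewrite acosK ?in_itv //= sin_acos // b2 sqrtr_sqr ger0_norm // divr_ge0 // ltW.
rewrite cosN sinN acosK ?in_itv //= sin_acos // b2 sqrtr_sqr ler0_norm ?opprK //.
by rewrite pmulr_lle0 ?invr_gt0 // ltW.
Qed.

Lemma ler_norm_sin (R : realType) (x : R) : `|sin x| <= `|x|.
Proof.
wlog x0 : x / 0 <= x.
  move=> h; have [/h //|/ltW x0] := leP 0 x.
  by rewrite -normrN -sinN -(normrN x); apply: h; rewrite oppr_ge0.
have [c _] := @MVT_segment R sin cos 0 x x0 (fun y _ => is_derive_sin y)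
  (continuous_subspaceT (@continuous_sin R)).
rewrite sin0 !subr0 => ->; rewrite normrM -[leRHS]mul1r.
by rewrite ler_wpM2r // cos_max.
Qed.

Lemma ler_norm_cosB1 (R : realType) (x : R) : `|cos x - 1| <= x ^+ 2.
Proof.
wlog x0 : x / 0 <= x.
  move=> h; have [/h //|/ltW x0] := leP 0 x.
  by rewrite -cosN -(sqrrN x); apply: h; rewrite oppr_ge0.
have [c] := @MVT_segment R cos (fun y => - sin y) 0 x x0
  (fun y _ => is_derive_cos y) (continuous_subspaceT (@continuous_cos R)).
rewrite in_itv /= => /andP[c0 cx]; rewrite cos0 subr0 => ->.
rewrite normrM normrN expr2 (ger0_norm x0) ler_wpM2r //.
by rewrite (le_trans (ler_norm_sin c)) // ger0_norm.
Qed.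

Lemma ler_norm_sinB (R : realType) (x : R) : `|x| <= 1 -> `|sin x - x| <= x ^+ 2.
Proof.
wlog x0 : x / 0 <= x.
  move=> h; have [/h //|/ltW x0 x1] := leP 0 x.
  rewrite -normrN opprB addrC -sinN -(sqrrN x) -[X in sin _ + X]opprK.
  by apply: h; rewrite ?oppr_ge0 // normrN.
rewrite ger0_norm // => x1.
have [c] := @MVT_segment R sin cos 0 x x0 (fun y _ => is_derive_sin y)
  (continuous_subspaceT (@continuous_sin R)).
rewrite in_itv /= => /andP[c0 cx]; rewrite sin0 !subr0 => ->.
rewrite -[X in _ - X]mul1r -mulrBl normrM (ger0_norm x0) expr2 ler_wpM2r //.
by rewrite (le_trans (ler_norm_cosB1 c)) //; nra.
Qed.

(** Both halves come from the tangent inequality [1 + t <= expR t], at [x] and at [- x]. *)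
Lemma expR_taylor1 (R : realType) (x : R) : `|x| <= 1 / 2 ->
  0 <= expR x - 1 - x <= 2 * x ^+ 2.
Proof.
rewrite ler_norml => /andP[x1 x2]; apply/andP; split.
  by have := expR_ge1Dx x; lra.
have h : expR x * (1 - x) <= 1.
  by have := ler_wpM2l (expR_ge0 x) (expR_ge1Dx (- x)); rewrite expRxMexpNx_1.
by have := expR_ge1Dx x; nra.
Qed.

Lemma cexp_taylor1 (R : realType) (h : R[i]) : normc h <= 1 / 2 ->
  normc (cexp h - 1 - h) <= 4 * normc h ^+ 2.
Proof.
move=> h2; have hx := le_trans (ler_normRe h) h2.
have hy := le_trans (ler_normIm h) h2.
have hN : normc h ^+ 2 = Re h ^+ 2 + Im h ^+ 2.
  by case: (h) => u v /=; rewrite sqr_sqrtr // addr_ge0 ?sqr_ge0.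
rewrite hN {hN h2}.
apply: le_trans (normc_le_ReIm _) _.
case: h hx hy => x y /= hx hy.
have /andP[e1 e2] := expR_taylor1 hx.
have c1 := ler_norm_cosB1 y.
have s1 : `|sin y - y| <= y ^+ 2 by apply: ler_norm_sinB; lra.
have s0 := ler_norm_sin y.
have -> : expR x * cos y - 1 - x = (expR x - 1 - x) * cos y + (1 + x) * (cos y - 1) by ring.
rewrite subr0.
have -> : expR x * sin y - y = (expR x - 1) * sin y + (sin y - y) by ring.
have t1 : `|(expR x - 1 - x) * cos y| <= 2 * x ^+ 2.
  rewrite normrM (ger0_norm e1) -[leRHS]mulr1.
  by rewrite ler_pM // cos_max.
have t2 : `|(1 + x) * (cos y - 1)| <= 3 / 2 * y ^+ 2.
  rewrite normrM ler_pM // ler_norml; move: hx; rewrite ler_norml => /andP[]; lra.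
have t3 : `|(expR x - 1) * sin y| <= x ^+ 2 + y ^+ 2.
  rewrite normrM.
  have h1 : `|expR x - 1| <= 2 * `|x|.
    have -> : expR x - 1 = (expR x - 1 - x) + x by ring.
    rewrite (le_trans (ler_normD _ _)) // (ger0_norm e1).
    have : x ^+ 2 = `|x| ^+ 2 by rewrite real_normK ?num_real.
    by have := normr_ge0 x; nra.
  apply: (le_trans (ler_pM _ _ h1 s0)) => //.
  have : x ^+ 2 = `|x| ^+ 2 by rewrite real_normK ?num_real.
  have : y ^+ 2 = `|y| ^+ 2 by rewrite real_normK ?num_real.
  by move=> -> ->; have := sqr_ge0 (`|x| - `|y|); nra.
have := ler_normD ((expR x - 1 - x) * cos y) ((1 + x) * (cos y - 1)).
have := ler_normD ((expR x - 1) * sin y) (sin y - y).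
have := sqr_ge0 x; have := sqr_ge0 y; lra.
Qed.

(** This is the dictionary between relative distances in the plane and distances in the logarithmic
    coordinate; each passage through it costs a factor 2. *)
Lemma cexpB1_bounds (R : realType) (h : R[i]) : normc h <= 1 / 8 ->
  normc h / 2 <= normc (cexp h - 1) <= 2 * normc h.
Proof.
move=> h8; have := normc_ge0 h => h0.
have t : normc (cexp h - 1 - h) <= 4 * normc h ^+ 2 by apply: cexp_taylor1; lra.
have hh : 4 * normc h ^+ 2 <= normc h / 2 by nra.
have := ler_normcD (cexp h - 1 - h) h; rewrite subrK.
have := lerB_normcD h (cexp h - 1 - h); rewrite [h + _]addrC subrK.
move=> *; apply/andP; split; lra.
Qed.

Lemma ler_norm_atan (R : realType) (x : R) : `|atan x| <= `|x|.
Proof.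
wlog x0 : x / 0 <= x.
  move=> h; have [/h //|/ltW x0] := leP 0 x.
  by rewrite -normrN -atanN -(normrN x); apply: h; rewrite oppr_ge0.
have [c _] := @MVT_segment R atan (fun y => (1 + y ^+ 2)^-1) 0 x x0
  (fun y _ => is_derive1_atan y) (continuous_subspaceT (@continuous_atan R)).
rewrite atan0 !subr0 => ->; rewrite normrM -[leRHS]mul1r.
rewrite ler_wpM2r // ger0_norm ?invr_ge0 ?addr_ge0 ?sqr_ge0 //.
by rewrite invf_le1 ?lerDl ?sqr_ge0 // ltr_pwDl ?sqr_ge0.
Qed.

(** The principal logarithm, written with [ln] and [atan], satisfies the crude bound 4 |x|. Under
    the hypothesis this is at most 1 / 8, so [cexpB1_bounds] applies and improves the constant to
    2. *)
Lemma clog_near1 (R : realType) (x : R[i]) : normc x <= 1 / 32 ->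
  exists h : R[i], normc h <= 2 * normc x /\ cexp h = 1 + x.
Proof.
move=> x32; have x0 := normc_ge0 x.
have [a b] : `|Re x| <= 1 / 32 /\ `|Im x| <= 1 / 32.
  by split; apply: le_trans x32; [exact: ler_normRe|exact: ler_normIm].
have a2 : 1 / 2 <= 1 + Re x by move: a; rewrite ler_norml => /andP[]; lra.
have z0 : 1 + x != 0 by apply/eqP => /(congr1 (@complex.Re _)); rewrite ReD /=; lra.
have r0 : 0 < normc (1 + x) by rewrite normc_gt0.
pose t := Im x / (1 + Re x).
pose h := ln (normc (1 + x)) +i* atan t.
have rE : normc (1 + x) ^+ 2 = (1 + Re x) ^+ 2 + Im x ^+ 2.
  by case: (x) => u v /=; rewrite add0r sqr_sqrtr // addr_ge0 ?sqr_ge0.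
have s0 : Num.sqrt (1 + t ^+ 2) = normc (1 + x) / (1 + Re x).
  have -> : 1 + t ^+ 2 = (normc (1 + x) / (1 + Re x)) ^+ 2.
    rewrite [RHS]expr_div_n rE /t; field; lra.
  by rewrite sqrtr_sqr ger0_norm // divr_ge0; lra.
have co : cos (atan t) = (1 + Re x) / normc (1 + x).
  by rewrite cos_atan s0 invf_div.
have si : sin (atan t) = Im x / normc (1 + x).
  have : tan (atan t) = t by exact: atanK.
  rewrite /tan co => e.
  have c0 : (1 + Re x) / normc (1 + x) != 0.
    by rewrite mulf_neq0 ?invr_neq0 ?gt_eqF //; lra.
  rewrite -[LHS](mulfVK c0) e /t; field; rewrite gt_eqF //; lra.
have eh : cexp h = 1 + x.
  rewrite /cexp /h /= lnK ?posrE // co si !(mulrC (normc _)) !mulfVK ?gt_eqF //.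
  by apply/eqP; rewrite eq_complex /= ReD ImD /= add0r !eqxx.
have h4 : normc h <= 4 * normc x.
  apply: (le_trans (normc_le_ReIm _)); rewrite /h /=.
  have ha : `|atan t| <= 2 * normc x.
    apply: (le_trans (ler_norm_atan _)); rewrite /t normrM normfV.
    rewrite [X in _ / X]ger0_norm ?ler_pdivrMr; try lra.
    by have := ler_normIm x; nra.
  have r1 : normc (1 + x) <= 1 + normc x.
    by have := ler_normcD 1 x; rewrite normc1.
  have r2 : 1 - normc x <= normc (1 + x).
    by have := lerB_normcD 1 x; rewrite normc1.
  have hl : `|ln (normc (1 + x))| <= 2 * normc x.
    rewrite ler_norml; apply/andP; split; last first.
      have : ln (1 + (normc (1 + x) - 1)) <= normc (1 + x) - 1 by apply: le_ln1Dx; lra.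
      by rewrite addrC subrK; lra.
    have : ln (1 + ((normc (1 + x))^-1 - 1)) <= (normc (1 + x))^-1 - 1.
      by apply: le_ln1Dx; have := invr_gt0 (normc (1 + x)); rewrite r0; lra.
    rewrite addrC subrK lnV ?posrE //.
    have : (normc (1 + x))^-1 - 1 <= 2 * normc x.
      rewrite lerBlDr -div1r ler_pdivrMr //; nra.
    by lra.
  lra.
exists h; split => //.
have : normc h / 2 <= normc (cexp h - 1) <= 2 * normc h by apply: cexpB1_bounds; lra.
by rewrite eh [1 + x]addrC addrK => /andP[]; lra.
Qed.

(** * Bounded solutions of the inhomogeneous Fibonacci recursion *)

(** The sequences [u n - B * q ^+ n] and [u n + B * q ^+ n] are monotone in opposite directions, so
    a supremum is squeezed between them and the rate comes for free. *)
Lemma geometric_limit_real (R : realType) (u : nat -> R) (B q : R) :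
  0 <= B -> 0 <= q < 1 ->
  (forall n, `|u n.+1 - u n| <= B * (1 - q) * q ^+ n) ->
  exists l, forall n, `|u n - l| <= B * q ^+ n.
Proof.
move=> B0 /andP[q0 q1] hu.
pose a n := u n - B * q ^+ n; pose b n := u n + B * q ^+ n.
have ua n : a n <= a n.+1.
  by have := hu n; rewrite /a exprS ler_norml => /andP[]; nra.
have ub n : b n.+1 <= b n.
  by have := hu n; rewrite /b exprS ler_norml => /andP[]; nra.
have am : {homo a : m n / (m <= n)%N >-> m <= n} by apply/nondecreasing_seqP.
have bm : {homo b : n m / (n <= m)%N >-> (m <= n)%O}.
  by apply/nonincreasing_seqP.
have ab m n : a m <= b n.
  apply: (le_trans (am _ _ (leq_maxl m n))); apply: le_trans (bm _ _ (leq_maxr m n)).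
  by rewrite /a /b; have := mulr_ge0 B0 (exprn_ge0 (maxn m n) q0); lra.
have sa : has_sup (range a).
  by split; [exists (a 0%N), 0%N | exists (b 0%N) => _ [n _ <-]].
exists (sup (range a)) => n.
have h1 : a n <= sup (range a) by apply: ub_le_sup; [case: sa|exists n].
have h2 : sup (range a) <= b n.
  by apply: ge_sup; [case: sa|move=> _ [m _ <-]].
by rewrite ler_norml; apply/andP; split; rewrite /a /b in h1 h2; lra.
Qed.

Lemma geometric_limit (R : realType) (u : nat -> R[i]) (B q : R) :
  0 <= B -> 0 <= q < 1 ->
  (forall n, normc (u n.+1 - u n) <= B * (1 - q) * q ^+ n) ->
  exists l, forall n, normc (u n - l) <= 2 * B * q ^+ n.
Proof.
move=> B0 q01 hu.
have [|x hx] := @geometric_limit_real R (fun n => Re (u n)) B q B0 q01.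
  by move=> n; rewrite -ReB (le_trans (ler_normRe _)).
have [|y hy] := @geometric_limit_real R (fun n => Im (u n)) B q B0 q01.
  by move=> n; rewrite -ImB (le_trans (ler_normIm _)).
exists (x +i* y) => n; apply: (le_trans (normc_le_ReIm _)).
by rewrite ReB ImB /=; have := hx n; have := hy n; lra.
Qed.

(** The a priori bound [B] only makes the supremum finite; the supremum [M] then satisfies
    [M <= q * M + h], and [B] disappears. *)
Lemma self_improving_bound (R : realType) (u : nat -> R) (B q h : R) :
  (forall n, u n <= B) ->
  (forall M, (forall n, u n <= M) -> forall n, u n <= q * M + h) ->
  q < 1 -> forall n, (1 - q) * u n <= h.
Proof.
move=> uB step q1 n.
have su : has_sup (range u).
  by split; [exists (u 0%N), 0%N | exists B => _ [m _ <-]].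
have us m : u m <= sup (range u) by apply: ub_le_sup; [case: su|exists m].
have : sup (range u) <= q * sup (range u) + h.
  by apply: ge_sup; [case: su|move=> _ [m _ <-]; exact: step].
by have := us n; nra.
Qed.

Definition golden (R : realType) : R := (1 + Num.sqrt 5) / 2.

Lemma golden_sqr (R : realType) : golden R ^+ 2 = golden R + 1.
Proof.
have : Num.sqrt (5 : R) ^+ 2 = 5 by rewrite sqr_sqrtr.
by rewrite /golden => h; field: h.
Qed.

Lemma golden_bounds (R : realType) : 3 / 2 <= golden R <= 2.
Proof.
have h : Num.sqrt (5 : R) ^+ 2 = 5 by rewrite sqr_sqrtr.
have h0 := sqrtr_ge0 (5 : R); rewrite /golden.
have : 2 <= Num.sqrt (5 : R) by nra.
have : Num.sqrt (5 : R) <= 3 by nra.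
by move=> *; apply/andP; split; lra.
Qed.

Section FibonacciRecursion.
Variables (R : realType) (h d : nat -> R[i]) (H : R).
Hypothesis hH : forall n, normc (h n) <= H.
Hypothesis dS : forall n, d n.+2 = d n.+1 + d n + h n.

Local Notation phi := (golden R).
Local Notation phic := ((golden R)%:C).
(** Coordinates along the two eigenvectors of the Fibonacci matrix: up to the perturbation, [L] is
    multiplied by phi and [M] by - 1 / phi at each step. *)
Let L n := phic * d n.+1 + d n.
Let M n := d n.+1 - phic * d n.

Let phic2 : phic ^+ 2 = phic + 1.
Proof. by rewrite -rmorphXn golden_sqr rmorphD rmorph1. Qed.

Let norm_phic : normc phic = phi.
Proof.
by rewrite normcR ger0_norm //; have := golden_bounds R; move=> /andP[]; lra.
Qed.

Let LS n : L n.+1 = phic * L n + phic * h n.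
Proof. by rewrite /L dS; ring: phic2. Qed.

Let MS n : phic * M n.+1 = phic * h n - M n.
Proof. by rewrite /M dS; ring: phic2. Qed.

Let dLM n : (phic ^+ 2 + 1) * d n = L n - phic * M n.
Proof. by rewrite /L /M; ring: phic2. Qed.

Let H0 : 0 <= H. Proof. exact: le_trans (normc_ge0 _) (hH 0). Qed.

Let M_bound (K : R) : normc (M 0) <= K -> phi ^+ 2 * H <= K ->
  forall n, normc (M n) <= K.
Proof.
move=> M0 HK; elim=> [//|n IH].
have := ler_normcB (phic * h n) (M n).
rewrite -MS !normcM norm_phic; have := hH n; have /andP[] := golden_bounds R.
have := golden_sqr R; have := normc_ge0 (M n.+1).
by move=> ? e ? ? ? ?; rewrite e in HK; nra.
Qed.

Let d_bound (A B : R) n : normc (L n) <= A -> normc (M n) <= B ->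
  (phi + 2) * normc (d n) <= A + phi * B.
Proof.
move=> LA MB; have := ler_normcB (L n) (phic * M n).
have -> : L n - phic * M n = (phi + 2)%:C * d n.
  by rewrite -dLM phic2 -addrA -mulr2n rmorphD rmorph_nat.
rewrite !normcM norm_phic normcR ger0_norm; last first.
  by have /andP[] := golden_bounds R; lra.
by have /andP[] := golden_bounds R; nra.
Qed.

(* A bounded solution has no component along the expanding eigenvector. *)
Lemma fib_bounded (B : R) : d 0%N = d 1%N -> (forall n, normc (d n) <= B) ->
  forall n, normc (d n) <= 2 * H.
Proof.
move=> d01 dB; have /andP[p1 p2] := golden_bounds R; have p3 := golden_sqr R.
have p0 : 0 < phi by lra.
have pn0 : phi != 0 by rewrite gt_eqF.
have LH n : normc (L n) <= (phi + 1) * H.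
  (* Read backwards, the recursion for [L] contracts by 1 / phi, so the bound on a bounded solution
     improves itself. *)
  have st (K : R) : (forall m, normc (L m) <= K) ->
      forall m, normc (L m) <= phi^-1 * K + H.
    move=> LK m; rewrite -(ler_pM2l p0) mulrDr mulrA mulfV // mul1r.
    have := ler_normcB (L m.+1) (phic * h m).
    rewrite LS addrK -LS !normcM norm_phic.
    by have := LK m.+1; have := hH m; nra.
  have LB m : normc (L m) <= phi * B + B.
    rewrite (le_trans (ler_normcD _ _)) // normcM norm_phic.
    by have := dB m.+1; have := dB m; nra.
  have q1 : phi^-1 < 1 by rewrite invf_lt1; lra.
  have := self_improving_bound LB st q1 n.
  rewrite -(ler_pM2l p0) mulrA mulrBr mulr1 mulfV //.
  have := normc_ge0 (L n) => l0 h1.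
  have p4 : 0 < phi - 1 by lra.
  rewrite -(ler_pM2l p4).
  by have -> : (phi - 1) * ((phi + 1) * H) = phi * H by ring: p3.
have d0 : normc (d 0%N) <= H.
  have := LH 0%N; rewrite /L -d01 -[X in _ + X]mul1r -mulrDl -phic2 normcM normcX.
  by rewrite norm_phic p3 ler_pM2l //; lra.
have M0 : normc (M 0%N) <= phi ^+ 2 * H.
  rewrite /M -d01 -[X in X - _]mul1r -mulrBl normcM.
  rewrite -(rmorph1 (real_complex R)) -rmorphB normcR.
  rewrite ler0_norm; last lra.
  by rewrite p3; have := normc_ge0 (d 0%N); nra.
(* (phi + 1) + phi ^ 3 = 3 phi + 2 is at most 2 (phi + 2) because phi <= 2; hence the factor 2. *)
move=> n; have := d_bound (LH n) (M_bound M0 (lexx _) n).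
rewrite p3; have := normc_ge0 (d n); have := H0; nra.
Qed.

Lemma fib_bounded_of_limit (A : R) :
  (forall n, normc (L n) <= A) -> exists B, forall n, normc (d n) <= B.
Proof.
move=> LA; exists (A + phi * (normc (M 0%N) + phi ^+ 2 * H)) => n.
have hM : normc (M n) <= normc (M 0%N) + phi ^+ 2 * H.
  apply: M_bound.
    by rewrite lerDl mulr_ge0 // exprn_ge0 //; have /andP[] := golden_bounds R; lra.
  by rewrite lerDr normc_ge0.
have := d_bound (LA n) hM; have := normc_ge0 (d n).
by have /andP[] := golden_bounds R; nra.
Qed.

Lemma fib_expanding_part n :
  L n = phic ^+ n * (L 0%N + \sum_(k < n) phic * h k / phic ^+ k.+1).
Proof.
have p0 : phic != 0.
  by rewrite -normc_gt0 norm_phic; have /andP[] := golden_bounds R; lra.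
elim: n => [|n IH]; first by rewrite big_ord0 expr0 addr0 mul1r.
rewrite LS IH big_ord_recr /= addrA [RHS]mulrDr exprS; congr (_ + _).
  by rewrite mulrA.
by rewrite mulrCA -exprS mulfV ?mulr1 // expf_neq0.
Qed.

End FibonacciRecursion.

Fixpoint fib_sol (R : realType) (x : R[i]) (h : nat -> R[i]) n : R[i] :=
  match n with
  | 0 => x
  | n1.+1 => match n1 with
            | 0 => x
            | n2.+1 => fib_sol x h n1 + fib_sol x h n2 + h n2
            end
  end.

(** Equal initial values [x] leave one free scalar, and the expanding coordinate at time 0 is phi ^
    2 times it. Taking it to be minus the sum of the series in [fib_expanding_part] leaves only phi
    ^ n times a tail of order phi ^ (- n). *)
Lemma fib_bounded_exists (R : realType) (h : nat -> R[i]) (H : R) :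
  (forall n, normc (h n) <= H) ->
  exists d : nat -> R[i], [/\ d 0%N = d 1%N,
    forall n, d n.+2 = d n.+1 + d n + h n & forall n, normc (d n) <= 2 * H].
Proof.
move=> hH; have H0 : 0 <= H := le_trans (normc_ge0 _) (hH 0%N).
have /andP[p1 p2] := golden_bounds R.
pose phic := (golden R)%:C.
have nphic : normc phic = golden R by rewrite normcR ger0_norm //; lra.
have p0 : phic != 0 by rewrite -normc_gt0 nphic; lra.
have p0' : golden R != 0 by rewrite gt_eqF //; lra.
have q1 : 0 <= (golden R)^-1 < 1.
  by rewrite invr_ge0 invf_lt1; try lra; rewrite andbT; lra.
pose S n := \sum_(k < n) phic * h k / phic ^+ k.+1.
pose q := (golden R)^-1.
have B0 : 0 <= H / (1 - q).
  by rewrite divr_ge0 // subr_ge0; case/andP: q1 => _ /ltW.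
have [|l hl] := @geometric_limit R S (H / (1 - q)) q B0 q1.
  move=> n; rewrite /S big_ord_recr /= addrC addrK.
  rewrite exprS invfM mulrA [phic * _]mulrC mulfK // normcM normcV normcX nphic.
  rewrite divfK; last by rewrite subr_eq0 eq_sym lt_eqF //; case/andP: q1.
  by rewrite exprVn ler_wpM2r // invr_ge0 exprn_ge0 //; lra.
pose x := - l / phic ^+ 2; pose d := fib_sol x h.
have dS n : d n.+2 = d n.+1 + d n + h n by [].
have pc2 : phic ^+ 2 = phic + 1 by rewrite -rmorphXn golden_sqr rmorphD rmorph1.
have [|B hB] := @fib_bounded_of_limit R h d H hH dS (2 * (H / (1 - q))).
  move=> n; rewrite (fib_expanding_part dS).
  have -> : phic * d 1%N + d 0%N = - l.
    rewrite /d /= -[X in _ + X]mul1r -mulrDl -pc2 /x mulrC divfK //.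
    by rewrite expf_neq0.
  rewrite addrC normcM normcX nphic.
  apply: (@le_trans _ _ (golden R ^+ n * (2 * (H / (1 - q)) * q ^+ n))).
    by rewrite ler_wpM2l ?hl // exprn_ge0 //; lra.
  by rewrite mulrCA -exprMn mulfV // expr1n mulr1.
by exists d; split => //; exact: (fib_bounded hH dS (erefl : d 0%N = d 1%N) hB).
Qed.

(** * The cut-off perturbation in the logarithmic coordinate *)

Definition clog1 (R : realType) (x : R[i]) : R[i] :=
  xget 0 [set h | normc h <= 2 * normc x /\ cexp h = 1 + x].

Lemma clog1P (R : realType) (x : R[i]) : normc x <= 1 / 32 ->
  normc (clog1 x) <= 2 * normc x /\ cexp (clog1 x) = 1 + x.
Proof.
move=> /clog_near1 [h hh]; rewrite /clog1.
exact: (@xgetPex _ 0 [set h | normc h <= 2 * normc x /\ cexp h = 1 + x] (ex_intro _ h hh)).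
Qed.

(** [clog1] is only a chosen preimage, so its increments are read off the exponential: they are
    short, and [cexp] of the increment is 1 + (x - y) / (1 + y). *)
Lemma clog1_diff (R : realType) (x y : R[i]) :
  normc x <= 1 / 32 -> normc y <= 1 / 32 ->
  normc (clog1 x - clog1 y) <= 4 * normc (x - y) /\
  normc (clog1 x - clog1 y - (x - y) / (1 + y)) <= 64 * normc (x - y) ^+ 2.
Proof.
move=> hx hy; have [h1 h2] := clog1P hx; have [k1 k2] := clog1P hy.
set h := clog1 x in h1 h2 *; set k := clog1 y in k1 k2 *.
have hk : normc (h - k) <= 1 / 8 by have := ler_normcB h k; lra.
have y1 : 1 + y != 0 by rewrite -k2 cexp_neq0.
have ny : 1 / 2 <= normc (1 + y).
  by have := lerB_normcD 1 y; rewrite normc1; lra.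
have e : cexp (h - k) - 1 = (x - y) / (1 + y).
  by rewrite cexpB h2 k2; field.
have l : normc (h - k) <= 4 * normc (x - y).
  have /andP[+ _] := cexpB1_bounds hk; rewrite e normcM normcV => h0.
  have : normc (x - y) / normc (1 + y) <= 2 * normc (x - y).
    by rewrite ler_pdivrMr; have := normc_ge0 (x - y); nra.
  lra.
split => //; rewrite -e -opprB normcNE.
have h2' : normc (h - k) <= 1 / 2 by lra.
have := cexp_taylor1 h2'; have := normc_ge0 (h - k); nra.
Qed.

Definition cutoff (R : realType) (x : R) : R := Num.max 0 (Num.min 1 (2 - `|x|)).

Lemma cutoff_bounds (R : realType) (x : R) : 0 <= cutoff x <= 1.
Proof. by rewrite /cutoff le_max lexx /= ge_max ler01 /= ge_min lexx. Qed.

Lemma cutoff_eq1 (R : realType) (x : R) : `|x| <= 1 -> cutoff x = 1.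
Proof. by rewrite /cutoff => ?; rewrite min_l ?max_r //; lra. Qed.

Lemma cutoff_eq0 (R : realType) (x : R) : 2 <= `|x| -> cutoff x = 0.
Proof. by rewrite /cutoff => ?; rewrite max_l // ge_min orbC; apply/orP; left; lra. Qed.

Lemma cutoff_lip (R : realType) (x y : R) : `|cutoff x - cutoff y| <= `|x - y|.
Proof.
have h1 := ler_dist_dist x y; rewrite /cutoff; apply: le_trans h1.
set u := `|x|; set v := `|y|.
have mm (t : R) : Num.max 0 (Num.min 1 t) =
    if 1 <= t then 1 else if 0 <= t then t else 0.
  by case: (lerP 1 t) => h; [rewrite max_r|case: lerP].
rewrite !mm; have := ler_norm (u - v); have := ler_norm (- (u - v)); rewrite normrN.
case: (lerP 1 (2 - u)) => h; case: (lerP 1 (2 - v)) => h'; try case: (lerP 0 (2 - u)) => k;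
  try case: (lerP 0 (2 - v)) => k'; move=> *; rewrite ler_norml; apply/andP; split; lra.
Qed.

Definition eps (R : realType) (c s : R[i]) : R[i] :=
  (cutoff (Re s))%:C * clog1 (c * cexp (- s)).

(** The shadowing and distortion estimates use the perturbation only through these properties. In
    [adm_conformal], [mu] is the complex derivative at [s]. The excluded range 1 / 2 < |Re s| < 3 is
    wider than the transition zone 1 < |Re s| < 2 of the cut-off, so that the disk of radius 1 / 2
    about [s] avoids the latter. *)
Record admissible (R : realType) (delta : R) (e : R[i] -> R[i]) : Prop :=
  Admissible {
  adm_bound : forall s, normc (e s) <= delta;
  adm_lip : forall s t, normc (e s - e t) <= delta * normc (s - t);
  adm_per : forall s tau, cexp tau = 1 -> e (s + tau) = e s;
  adm_conformal : forall s, `|Re s| <= 1 / 2 \/ 3 <= `|Re s| ->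
    exists mu, forall t, normc (t - s) <= 1 / 2 ->
      normc (e t - e s - mu * (t - s)) <= delta * normc (t - s) ^+ 2;
  adm_far : forall s, 2 <= `|Re s| -> e s = 0 }.

Section Eps.
Variable R : realType.
Implicit Types c s t : R[i].

Local Notation K := (expR 2 : R).

(** The bound on [c] keeps [c * cexp (- s)] in the range 1 / 32 of [clog1P] on the whole support of
    the cut-off. *)
Let strip c s : normc c <= (32 * K)^-1 -> `|Re s| <= 2 ->
  normc (c * cexp (- s)) <= normc c * K /\ normc c * K <= 1 / 32.
Proof.
move=> hc hs; have K0 := expR_gt0 (2 : R); split.
  rewrite normcM ler_wpM2l ?normc_ge0 // normc_cexp ler_expR ReN.
  by move: hs; rewrite ler_norml => /andP[]; lra.
apply: (le_trans (ler_wpM2r (ltW K0) hc)).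
by rewrite invfM mulfVK ?gt_eqF //; lra.
Qed.

Let exp_lip s t : `|Re s| <= 2 -> `|Re t| <= 2 ->
  normc (cexp (- s) - cexp (- t)) <= 16 * K * normc (s - t).
Proof.
move=> hs ht; have K0 := expR_gt0 (2 : R).
have es : normc (cexp (- s)) <= K.
  by rewrite normc_cexp ler_expR ReN; move: hs; rewrite ler_norml => /andP[]; lra.
have et : normc (cexp (- t)) <= K.
  by rewrite normc_cexp ler_expR ReN; move: ht; rewrite ler_norml => /andP[]; lra.
have [h|h] := lerP (normc (s - t)) (1 / 8).
  have -> : cexp (- s) - cexp (- t) = - (cexp (- s) * (cexp (s - t) - 1)).
    by rewrite mulrBr -cexpD addrA addNr add0r mulr1 opprB.
  rewrite normcNE normcM; have /andP[_] := cexpB1_bounds h.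
  by have := normc_ge0 (cexp (s - t) - 1); have := normc_ge0 (s - t);
    have := normc_ge0 (cexp (- s)); nra.
by have := ler_normcB (cexp (- s)) (cexp (- t)); nra.
Qed.

Lemma eps_bound c s : normc c <= (32 * K)^-1 -> normc (eps c s) <= 2 * K * normc c.
Proof.
move=> hc; have K0 := expR_gt0 (2 : R); rewrite /eps.
have [h|/ltW h] := lerP `|Re s| 2; last first.
  by rewrite cutoff_eq0 // mul0r normc0; have := normc_ge0 c; nra.
have [h1 h2] := strip hc h; have /andP[b0 b1] := cutoff_bounds (Re s).
have [l1 _] := clog1P (le_trans h1 h2).
rewrite normcM normcR ger0_norm //; have := normc_ge0 (clog1 (c * cexp (- s))).
by nra.
Qed.

(** 66 = 2 + 64: the variation of the cut-off times the size of the logarithm, plus 4 from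
    [clog1_diff] times 16 from [exp_lip]. *)
Lemma eps_lip c s t : normc c <= (32 * K)^-1 ->
  normc (eps c s - eps c t) <= 66 * K * normc c * normc (s - t).
Proof.
move=> hc; have K0 := expR_gt0 (2 : R); have c0 := normc_ge0 c.
have Kc0 : 0 <= K * normc c by rewrite mulr_ge0 // ltW.
have st0 := normc_ge0 (s - t).
have hcut : `|cutoff (Re s) - cutoff (Re t)| <= normc (s - t).
  by rewrite (le_trans (cutoff_lip _ _)) // -ReB ler_normRe.
have main u v : `|Re u| <= 2 -> `|cutoff (Re u) - cutoff (Re v)| <= normc (s - t) ->
    normc ((cutoff (Re u) - cutoff (Re v))%:C * clog1 (c * cexp (- u))) <=
    2 * K * normc c * normc (s - t).
  move=> hu huv; have [h1 h2] := strip hc hu.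
  have [l1 _] := clog1P (le_trans h1 h2).
  rewrite normcM normcR mulrC ler_pM ?normc_ge0 //; lra.
rewrite /eps.
have [hs|/ltW hs] := lerP `|Re s| 2; last first.
  rewrite (cutoff_eq0 hs) mul0r sub0r normcNE.
  have [ht|/ltW ht] := lerP `|Re t| 2; last first.
    by rewrite (cutoff_eq0 ht) mul0r normc0; nra.
  have := main t s ht; rewrite distrC => /(_ hcut).
  by rewrite (cutoff_eq0 hs) subr0; nra.
have [ht|/ltW ht] := lerP `|Re t| 2; last first.
  have := main s t hs hcut.
  by rewrite (cutoff_eq0 ht) mul0r !subr0; nra.
have [h1 h2] := strip hc hs; have [k1 k2] := strip hc ht.
have [l _] := clog1_diff (le_trans h1 h2) (le_trans k1 k2).
have /andP[b0 b1] := cutoff_bounds (Re t).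
set ls := clog1 _ in l *; set lt := clog1 _ in l *.
have -> : (cutoff (Re s))%:C * ls - (cutoff (Re t))%:C * lt =
   (cutoff (Re s) - cutoff (Re t))%:C * ls + (cutoff (Re t))%:C * (ls - lt).
  by rewrite rmorphB /=; ring.
apply: (le_trans (ler_normcD _ _)).
have m1 := main s t hs hcut.
have m2 : normc ((cutoff (Re t))%:C * (ls - lt)) <= 64 * K * normc c * normc (s - t).
  rewrite normcM normcR ger0_norm //.
  have := exp_lip hs ht; rewrite -mulrBr normcM in l => e.
  have := normc_ge0 (ls - lt); nra.
by rewrite -/ls in m1; lra.
Qed.

Lemma eps_conformal c s : normc c <= (32 * K)^-1 ->
  `|Re s| <= 1 / 2 \/ 3 <= `|Re s| ->
  exists mu, forall t, normc (t - s) <= 1 / 2 ->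
    normc (eps c t - eps c s - mu * (t - s)) <= 66 * K * normc c * normc (t - s) ^+ 2.
Proof.
move=> hc; have K0 := expR_gt0 (2 : R); have c0 := normc_ge0 c.
have Kc0 : 0 <= K * normc c by rewrite mulr_ge0 // ltW.
case=> hs; last first.
  exists 0 => t hts; rewrite /eps !cutoff_eq0; try lra; last first.
    have h := ler_normRe (t - s); rewrite ReB in h.
    by have := lerB_dist (Re s) (Re t); rewrite distrC; lra.
  by rewrite !mul0r !subr0 normc0; have := sqr_ge0 (normc (t - s)); nra.
have hs2 : `|Re s| <= 2 by lra.
have [h1 h2] := strip hc hs2.
(* The slope is the derivative at [s] of log (1 + c e^(-s)); the cut-off equals 1 on the disk
   considered. *)
set y := c * cexp (- s) in h1; exists (- (y / (1 + y))) => t hts.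
have ht : `|Re t| <= 1.
  have h := ler_normRe (t - s); rewrite ReB in h.
  by have := lerB_dist (Re t) (Re s); lra.
rewrite /eps !cutoff_eq1 ?mul1r //; try lra.
have ht2 : `|Re t| <= 2 by lra.
have [k1 k2] := strip hc ht2; rewrite -/y; set x := c * cexp (- t) in k1 *.
have [_ l] := clog1_diff (le_trans k1 k2) (le_trans h1 h2).
have y1 : 1 + y != 0.
  by rewrite -normc_gt0; have := lerB_normcD 1 y; rewrite normc1; lra.
have ny : 1 / 2 <= normc (1 + y).
  by have := lerB_normcD 1 y; rewrite normc1; lra.
have hst : normc (s - t) <= 1 / 2 by rewrite normcBC.
have T := cexp_taylor1 hst.
have xy : x - y = y * (cexp (s - t) - 1).
  rewrite /x /y mulrBr mulr1 -mulrA -cexpD; congr (_ * cexp _ - _); ring.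
have nxy : normc (x - y) <= 3 * normc y * normc (s - t).
  rewrite xy normcM; have := ler_normcD (cexp (s - t) - 1 - (s - t)) (s - t).
  rewrite subrK; have := normc_ge0 y; have := normc_ge0 (s - t) => s0 y0 tri.
  have : normc (cexp (s - t) - 1) <= 3 * normc (s - t) by nra.
  nra.
have -> : (clog1 x - clog1 y) - - (y / (1 + y)) * (t - s) =
  (clog1 x - clog1 y - (x - y) / (1 + y)) +
  y / (1 + y) * (cexp (s - t) - 1 - (s - t)).
  by rewrite xy; field.
apply: (le_trans (ler_normcD _ _)).
have m2 : normc (y / (1 + y) * (cexp (s - t) - 1 - (s - t))) <=
  8 * normc y * normc (s - t) ^+ 2.
  rewrite 2!normcM normcV; have y0 := normc_ge0 y.
  have h3 : normc y / normc (1 + y) <= 2 * normc y.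
    by rewrite ler_pdivrMr; nra.
  have -> : 8 * normc y * normc (s - t) ^+ 2 = (2 * normc y) * (4 * normc (s - t) ^+ 2) by ring.
  by rewrite ler_pM ?normc_ge0 // mulr_ge0 ?invr_ge0 ?normc_ge0.
have m1 : 64 * normc (x - y) ^+ 2 <= 18 * normc y * normc (s - t) ^+ 2.
  have : normc (x - y) ^+ 2 <= (3 * normc y * normc (s - t)) ^+ 2.
    by rewrite lerXn2r ?nnegrE ?mulr_ge0 ?normc_ge0.
  have -> : (3 * normc y * normc (s - t)) ^+ 2 = 9 * normc y * (normc y * normc (s - t) ^+ 2) by ring.
  have := mulr_ge0 (normc_ge0 y) (sqr_ge0 (normc (s - t))) => p q.
  have : normc y * (normc y * normc (s - t) ^+ 2) <= 1 / 32 * (normc y * normc (s - t) ^+ 2).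
    by rewrite ler_wpM2r //; lra.
  lra.
have := sqr_ge0 (normc (s - t)); rewrite (normcBC t s) => q0.
have : normc y * normc (s - t) ^+ 2 <= K * normc c * normc (s - t) ^+ 2.
  by rewrite ler_wpM2r //; lra.
have := mulr_ge0 Kc0 q0; lra.
Qed.

(** Where the cut-off is 1, exponentiating a step of the perturbed recursion gives the product plus
    [c]: the logarithmic orbit is a true one. *)
Lemma eps_exp c s : normc c <= (32 * K)^-1 -> `|Re s| <= 1 ->
  cexp (s + eps c s) = cexp s + c.
Proof.
move=> hc hs; have hs2 : `|Re s| <= 2 by lra.
have [h1 h2] := strip hc hs2.
rewrite cexpD /eps cutoff_eq1 // mul1r (clog1P (le_trans h1 h2)).2.
by rewrite mulrDr mulr1 mulrCA -cexpD subrr cexp0 mulr1.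
Qed.

Lemma eps_param c c' s : normc c <= (32 * K)^-1 -> normc c' <= (32 * K)^-1 ->
  normc (eps c s - eps c' s) <= 4 * K * normc (c - c').
Proof.
move=> hc hc'; have K0 := expR_gt0 (2 : R); have c0 := normc_ge0 (c - c').
rewrite /eps -mulrBr.
have [hs|/ltW hs] := lerP `|Re s| 2; last first.
  by rewrite cutoff_eq0 // mul0r normc0; nra.
have [h1 h2] := strip hc hs; have [k1 k2] := strip hc' hs.
have [l _] := clog1_diff (le_trans h1 h2) (le_trans k1 k2).
have /andP[b0 b1] := cutoff_bounds (Re s).
rewrite normcM normcR ger0_norm //; rewrite -mulrBl normcM normc_cexp in l.
have : expR (Re (- s)) <= K.
  by rewrite ler_expR ReN; move: hs; rewrite ler_norml => /andP[]; lra.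
have := expR_gt0 (Re (- s)); have := normc_ge0 (clog1 (c * cexp (- s)) - clog1 (c' * cexp (- s))).
by nra.
Qed.

Lemma eps_admissible c delta :
  normc c <= (32 * K)^-1 -> 66 * K * normc c <= delta -> admissible delta (eps c).
Proof.
move=> hc hd; have K0 := expR_gt0 (2 : R); have c0 := normc_ge0 c.
split.
- by move=> s; have := eps_bound s hc; nra.
- move=> s t; apply: (le_trans (eps_lip s t hc)).
  by rewrite ler_wpM2r ?normc_ge0.
- move=> s tau h; have t0 : Re tau = 0.
    by apply: expR_inj; rewrite -normc_cexp h normc1 expR0.
  by rewrite /eps ReD t0 addr0 opprD cexpD (cexpN tau) h invr1 mulr1.
- move=> s hs; have [mu hmu] := eps_conformal hc hs; exists mu => t ht.
  by apply: (le_trans (hmu t ht)); rewrite ler_wpM2r ?sqr_ge0.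
- by move=> s hs; rewrite /eps cutoff_eq0 // mul0r.
Qed.

End Eps.

(** * Perturbed Fibonacci orbits and their shadows *)

(** Indexed from 1, 1, so that [(fibn n)%:R * y] is the unperturbed orbit with both initial values
    [y]. *)
Fixpoint fibn n : nat :=
  match n with
  | 0 => 1
  | n1.+1 => match n1 with 0 => 1 | n2.+1 => fibn n1 + fibn n2 end
  end.

Lemma fibnSS n : fibn n.+2 = (fibn n.+1 + fibn n)%N. Proof. by []. Qed.

Lemma fibn_gt0 n : (0 < fibn n)%N.
Proof.
suff : (0 < fibn n)%N && (0 < fibn n.+1)%N by case/andP.
by elim: n => [//|n /andP[h1 h2]]; rewrite h2 fibnSS addn_gt0 h2.
Qed.

Lemma leq_fibn n : (n <= fibn n)%N.
Proof.
suff : (n <= fibn n)%N && (n.+1 <= fibn n.+1)%N by case/andP.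
elim: n => [//|n /andP[h1 h2]]; rewrite h2 fibnSS.
by have := fibn_gt0 n; lia.
Qed.

Lemma fibn_le n : (fibn n <= fibn n.+1)%N.
Proof. by case: n => // n; rewrite fibnSS leq_addr. Qed.

Lemma fibnS_le n : (fibn n.+1 <= 2 * fibn n)%N.
Proof. by case: n => // n; rewrite fibnSS; have := fibn_le n; lia. Qed.

Lemma fibn_doubling n : (2 * fibn n <= fibn n.+2)%N.
Proof. by rewrite fibnSS; have := fibn_le n; lia. Qed.

Fixpoint orb (R : realType) (e : R[i] -> R[i]) (w : R[i]) n : R[i] :=
  match n with
  | 0 => w
  | n1.+1 => match n1 with
            | 0 => w
            | n2.+1 => (orb e w n1 + orb e w n2) + e (orb e w n1 + orb e w n2)
            end
  end.

Definition sarg (R : realType) (e : R[i] -> R[i]) (w : R[i]) n :=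
  orb e w n.+1 + orb e w n.

Lemma orbSS (R : realType) (e : R[i] -> R[i]) w n :
  orb e w n.+2 = orb e w n.+1 + orb e w n + e (sarg e w n).
Proof. by []. Qed.

Definition shadow (R : realType) (e : R[i] -> R[i]) (w y : R[i]) : Prop :=
  exists B, forall n, normc (orb e w n - (fibn n)%:R * y) <= B.

Lemma le0_of_half_pow (R : realType) (X C : R) :
  (forall j, X <= C * (1 / 2) ^+ j) -> X <= 0.
Proof.
move=> h; rewrite leNgt; apply/negP => X0.
have C0 : 0 < C by have := h 0%N; rewrite expr0 mulr1; exact: lt_le_trans.
have := archi_boundP (ltW (divr_gt0 C0 X0)); set j := Num.bound _ => hj.
have := h j; rewrite expr_div_n expr1n div1r ler_pdivlMr ?exprn_gt0 //.
move=> h2; have : j%:R <= (2 : R) ^+ j.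
  by rewrite -natrX ler_nat ltnW // ltn_expl.
by rewrite ltr_pdivrMr // in hj; nra.
Qed.

Section Shadow.
Variables (R : realType) (delta : R).
Hypothesis delta8 : delta <= 1 / 8.
Implicit Types e : R[i] -> R[i].

Lemma shadow_bound e w y : admissible delta e -> shadow e w y ->
  forall n, normc (orb e w n - (fibn n)%:R * y) <= 2 * delta.
Proof.
move=> he [B hB]; apply: (@fib_bounded R (fun n => e (sarg e w n)) _ delta _ _ B) => //.
  by move=> n; exact: adm_bound he _.
by move=> n; rewrite orbSS fibnSS natrD; ring.
Qed.

(** Along the given orbit the perturbation is a known bounded sequence. Subtracting its bounded
    response leaves an exact Fibonacci sequence with equal initial values, hence a multiple of
    [fibn]. *)
Lemma shadow_ex_target e w : admissible delta e -> exists y, shadow e w y.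
Proof.
move=> he.
have [d [d01 dS dB]] := @fib_bounded_exists R (fun n => e (sarg e w n)) delta
  (fun n => adm_bound he _).
exists (w - d 0%N), (2 * delta) => n.
suff -> : orb e w n - (fibn n)%:R * (w - d 0%N) = d n by [].
suff : orb e w n - (fibn n)%:R * (w - d 0%N) = d n /\
       orb e w n.+1 - (fibn n.+1)%:R * (w - d 0%N) = d n.+1 by case.
elim: n => [|n [IH1 IH2]]; first by rewrite /= -d01; split; ring.
by split=> //; rewrite orbSS fibnSS natrD dS -IH1 -IH2; ring.
Qed.

(* The difference of two orbits with the same shadow is a bounded solution of
   a recursion whose right-hand side it controls itself. *)
Lemma shadow_diff e e' X w w' y : admissible delta e -> admissible delta e' ->
  (forall s, normc (e s - e' s) <= X) -> shadow e w y -> shadow e' w' y ->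
  normc (w - w') <= 4 * X.
Proof.
move=> he he' hX sw sw'; pose d n := orb e w n - orb e' w' n.
pose h n := e (sarg e w n) - e' (sarg e' w' n).
have dS n : d n.+2 = d n.+1 + d n + h n by rewrite /d /h !orbSS; ring.
have dB n : normc (d n) <= 4 * delta.
  have := shadow_bound he sw n; have := shadow_bound he' sw' n.
  have := ler_distcD ((fibn n)%:R * y) (orb e w n) (orb e' w' n).
  by rewrite (normcBC ((fibn n)%:R * y)) /d; lra.
(* The right-hand side is at most 2 delta M + X and [fib_bounded] doubles it; 4 delta <= 1 / 2
   closes the estimate. *)
have st (M : R) : (forall n, normc (d n) <= M) ->
    forall n, normc (d n) <= (1 / 2) * M + 2 * X.
  move=> dM; have hh n : normc (h n) <= delta * (2 * M) + X.
    have := ler_distcD (e (sarg e' w' n)) (e (sarg e w n)) (e' (sarg e' w' n)).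
    have := hX (sarg e' w' n); have := adm_lip he (sarg e w n) (sarg e' w' n).
    have -> : sarg e w n - sarg e' w' n = d n.+1 + d n by rewrite /sarg /d; ring.
    have dd : normc (d n.+1 + d n) <= 2 * M.
      by have := ler_normcD (d n.+1) (d n); have := dM n; have := dM n.+1; lra.
    have := ler_wpM2l (le_trans (normc_ge0 _) (adm_bound he 0)) dd; rewrite /h; lra.
  move=> n; have := @fib_bounded R h d _ hh dS M (erefl : d 0%N = d 1%N) dM n.
  by have := ler_wpM2r (le_trans (normc_ge0 _) (dM 0%N)) delta8; lra.
have q1 : (1 / 2 : R) < 1 by lra.
have := self_improving_bound dB st q1 0%N; rewrite /d /=; lra.
Qed.

(** The deviation [d] from the multiples of [y] must be the bounded response to a perturbation
    depending on [d] itself. Picard iteration from 0 contracts the sup norm by 4 delta <= 1 / 2, and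
    the limit is taken entry by entry. *)
Lemma shadow_ex_source e y : admissible delta e -> exists w, shadow e w y.
Proof.
move=> he; have d0 : 0 <= delta := le_trans (normc_ge0 _) (adm_bound he 0).
pose h (d : nat -> R[i]) n := e ((fibn n.+2)%:R * y + (d n.+1 + d n)).
have /choice[S hS] : forall d : nat -> R[i], exists d' : nat -> R[i],
    [/\ d' 0%N = d' 1%N, forall n, d' n.+2 = d' n.+1 + d' n + h d n &
        forall n, normc (d' n) <= 2 * delta].
  move=> d; have [d' hd'] := @fib_bounded_exists R (h d) delta (fun n => adm_bound he _).
  by exists d'.
pose D j := iter j S (fun=> 0).
have HD j : [/\ D j.+1 0%N = D j.+1 1%N,
    forall n, D j.+1 n.+2 = D j.+1 n.+1 + D j.+1 n + h (D j) n &
    forall n, normc (D j.+1 n) <= 2 * delta] := hS (D j).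
have DD j n : normc (D j.+1 n - D j n) <= 4 * delta * (1 - 1 / 2) * (1 / 2) ^+ j.
  have -> : 4 * delta * (1 - 1 / 2) = 2 * delta by field.
  elim: j n => [|j IH] n.
    by rewrite /= subr0 expr0 mulr1; case: (hS (fun=> 0)).
  have [a1 a2 a3] := HD j.+1; have [b1 b2 b3] := HD j.
  pose hh m := h (D j.+1) m - h (D j) m; pose dd m := D j.+2 m - D j.+1 m.
  have hhB m : normc (hh m) <= delta * (4 * delta * (1 / 2) ^+ j).
    apply: (le_trans (adm_lip he _ _)); rewrite ler_wpM2l //.
    have -> : (fibn m.+2)%:R * y + (D j.+1 m.+1 + D j.+1 m) -
      ((fibn m.+2)%:R * y + (D j m.+1 + D j m)) =
      (D j.+1 m.+1 - D j m.+1) + (D j.+1 m - D j m) by ring.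
    by have := ler_normcD (D j.+1 m.+1 - D j m.+1) (D j.+1 m - D j m);
      have := IH m; have := IH m.+1; lra.
  have ddS m : dd m.+2 = dd m.+1 + dd m + hh m.
    by rewrite /dd /hh a2 b2; ring.
  have dd01 : dd 0%N = dd 1%N by rewrite /dd a1 b1.
  have ddB m : normc (dd m) <= 4 * delta.
    by have := ler_normcB (D j.+2 m) (D j.+1 m); have := a3 m; have := b3 m;
      rewrite /dd; lra.
  apply: (le_trans (fib_bounded hhB ddS dd01 ddB n)).
  have p0 : 0 <= (1 / 2 : R) ^+ j by rewrite exprn_ge0.
  by rewrite exprS; have := ler_wpM2r (mulr_ge0 d0 p0) delta8; lra.
have h01 : 0 <= (1 / 2 : R) < 1 by lra.
have d40 : 0 <= 4 * delta by lra.
have /choice[d hd] : forall n, exists l, forall j,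
    normc (D j n - l) <= 2 * (4 * delta) * (1 / 2) ^+ j.
  by move=> n; exact: (geometric_limit d40 h01 (fun j => DD j n)).
have d01 : d 0%N = d 1%N.
  apply/eqP; rewrite -subr_eq0 -normc_eq0 eq_le normc_ge0 andbT.
  apply: (@le0_of_half_pow _ _ (16 * delta)) => j.
  have e01 : D j 0%N = D j 1%N.
    by case: j => [//|j]; case: (HD j).
  have := ler_distcD (D j 0%N) (d 0%N) (d 1%N); have := hd 0%N j; have := hd 1%N j.
  by rewrite -e01 (normcBC (d 0%N) (D j 0%N)); lra.
(* All entries converge at the rate (1 / 2) ^ j, so the defect in the recursion is below a constant
   times (1 / 2) ^ j for every [j]. *)
have dS n : d n.+2 = d n.+1 + d n + h d n.
  apply/eqP; rewrite -subr_eq0 -normc_eq0 eq_le normc_ge0 andbT.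
  apply: (@le0_of_half_pow _ _ (40 * delta)) => j.
  have [_ a2 _] := HD j.
  have H2 := hd n.+2 j.+1; have H1 := hd n.+1 j.+1; have H0 := hd n j.+1.
  have G1 := hd n.+1 j; have G0 := hd n j.
  rewrite exprS in H2 H1 H0.
  have p0 : 0 <= (1 / 2 : R) ^+ j by rewrite exprn_ge0.
  have E : normc (h (D j) n - h d n) <= delta * (16 * delta * (1 / 2) ^+ j).
    apply: (le_trans (adm_lip he _ _)); rewrite ler_wpM2l //.
    have -> : (fibn n.+2)%:R * y + (D j n.+1 + D j n) -
      ((fibn n.+2)%:R * y + (d n.+1 + d n)) = (D j n.+1 - d n.+1) + (D j n - d n) by ring.
    by have := ler_normcD (D j n.+1 - d n.+1) (D j n - d n); lra.
  have -> : d n.+2 - (d n.+1 + d n + h d n) =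
      - (D j.+1 n.+2 - d n.+2) + ((D j.+1 n.+1 - d n.+1) + ((D j.+1 n - d n) +
      (h (D j) n - h d n))).
    by rewrite a2; ring.
  have := ler_normcD (- (D j.+1 n.+2 - d n.+2)) ((D j.+1 n.+1 - d n.+1) + ((D j.+1 n - d n) +
      (h (D j) n - h d n))).
  have := ler_normcD (D j.+1 n.+1 - d n.+1) ((D j.+1 n - d n) + (h (D j) n - h d n)).
  have := ler_normcD (D j.+1 n - d n) (h (D j) n - h d n).
  by rewrite normcNE; have := ler_wpM2r (mulr_ge0 d0 p0) delta8; have := mulr_ge0 d0 p0; lra.
have orbE n : orb e (y + d 0%N) n = (fibn n)%:R * y + d n.
  suff : orb e (y + d 0%N) n = (fibn n)%:R * y + d n /\
     orb e (y + d 0%N) n.+1 = (fibn n.+1)%:R * y + d n.+1 by case.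
  elim: n => [|n [IH1 IH2]]; first by rewrite /= -d01 mul1r.
  split=> //; rewrite orbSS /sarg IH1 IH2 dS /h fibnSS natrD.
  have -> : (fibn n.+1)%:R * y + d n.+1 + ((fibn n)%:R * y + d n) =
    ((fibn n.+1)%:R + (fibn n)%:R) * y + (d n.+1 + d n) by ring.
  by ring.
exists (y + d 0%N), (2 * (4 * delta)) => n; rewrite orbE addrC addKr.
by have := hd n 0%N; rewrite /= sub0r normcNE expr0 mulr1.
Qed.

Lemma shadow_unique_target e w y y' : shadow e w y -> shadow e w y' -> y = y'.
Proof.
move=> [B hB] [B' hB']; apply/eqP; rewrite -subr_eq0 -normc_eq0.
rewrite eq_le normc_ge0 andbT leNgt; apply/negP => n0.
have BB n : n%:R * normc (y - y') <= B + B'.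
  apply: (@le_trans _ _ ((fibn n)%:R * normc (y - y'))).
    by rewrite ler_wpM2r ?normc_ge0 // ler_nat leq_fibn.
  rewrite -(normc_nat R (fibn n)) -normcM.
  have := ler_distcD (orb e w n) ((fibn n)%:R * y) ((fibn n)%:R * y').
  rewrite (normcBC _ (orb e w n)) -mulrBr; have := hB n; have := hB' n; lra.
have B0 : 0 <= B + B' by have := BB 0%N; rewrite mul0r.
have := archi_boundP (divr_ge0 B0 (ltW n0)).
by rewrite ltr_pdivrMr // ltNge BB.
Qed.

Lemma shadow_unique_source e w w' y : admissible delta e ->
  shadow e w y -> shadow e w' y -> w = w'.
Proof.
move=> he sw sw'; apply/eqP; rewrite -subr_eq0 -normc_eq0.
rewrite eq_le normc_ge0 andbT.
rewrite (le_trans (@shadow_diff e e 0 w w' y he he _ sw sw')) ?mulr0 //.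
by move=> s; rewrite subrr normc0.
Qed.

(** The shift by [tau] becomes the integer multiple [fibn n] of [tau] along the orbit, again a
    period of the perturbation. *)
Lemma shadow_period e w y tau : admissible delta e -> cexp tau = 1 ->
  shadow e w y -> shadow e (w + tau) (y + tau).
Proof.
move=> he ht [B hB]; exists B => n.
have htn m : cexp (m%:R * tau) = 1.
  by elim: m => [|m IH]; rewrite ?mul0r ?cexp0 // -natr1 mulrDl mul1r cexpD IH ht mulr1.
suff -> : orb e (w + tau) n = orb e w n + (fibn n)%:R * tau.
  by have := hB n; rewrite mulrDr opprD addrACA subrr addr0.
suff : orb e (w + tau) n = orb e w n + (fibn n)%:R * tau /\
    orb e (w + tau) n.+1 = orb e w n.+1 + (fibn n.+1)%:R * tau by case.
elim: n => [|n [IH1 IH2]]; first by rewrite /= mul1r.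
split=> //; rewrite orbSS /sarg IH1 IH2.
have -> : orb e w n.+1 + (fibn n.+1)%:R * tau + (orb e w n + (fibn n)%:R * tau) =
   sarg e w n + (fibn n.+2)%:R * tau by rewrite fibnSS natrD /sarg; ring.
by rewrite (adm_per he) // orbSS /sarg; ring.
Qed.

Lemma shadow_far e y : admissible delta e -> 2 <= `|Re y| -> shadow e y y.
Proof.
move=> he hy; exists 0 => n.
suff -> : orb e y n = (fibn n)%:R * y by rewrite subrr normc0.
suff : orb e y n = (fibn n)%:R * y /\ orb e y n.+1 = (fibn n.+1)%:R * y by case.
elim: n => [|n [IH1 IH2]]; first by rewrite /= mul1r.
split=> //; rewrite orbSS /sarg IH1 IH2 -mulrDl -natrD -fibnSS (adm_far he) ?addr0 //.
rewrite Re_natM normrM ger0_norm //.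
have : 1 <= (fibn n.+2)%:R :> R by rewrite ler1n fibn_gt0.
nra.
Qed.

Definition Psi e y : R[i] := xget 0 [set w | shadow e w y].
Definition Phi e w : R[i] := xget 0 [set y | shadow e w y].

Lemma PsiP e y : admissible delta e -> shadow e (Psi e y) y.
Proof.
move=> he; have h := shadow_ex_source y he.
exact: (@xgetPex _ 0 [set w | shadow e w y] h).
Qed.

Lemma PhiP e w : admissible delta e -> shadow e w (Phi e w).
Proof.
move=> he; have h := shadow_ex_target w he.
exact: (@xgetPex _ 0 [set y | shadow e w y] h).
Qed.

Lemma PhiK e : admissible delta e -> cancel (Phi e) (Psi e).
Proof.
move=> he w; apply: (shadow_unique_source he (PsiP _ he)); exact: PhiP.
Qed.

Lemma PsiK e : admissible delta e -> cancel (Psi e) (Phi e).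
Proof.
move=> he y; apply: (shadow_unique_target (PhiP _ he)); exact: PsiP.
Qed.

End Shadow.

(** * Distortion of the shadowing map *)

Lemma sum_window (P : pred nat) m n :
  (forall i j, P i -> P j -> (j < i + m)%N) -> (\sum_(k < n) P k <= m)%N.
Proof.
move=> win; have [[i Pi]|noP] := pselect (exists i, P i); last first.
  by rewrite big1 // => k _; case: (boolP (P k)) => // Pk; case: noP; exists k.
case: (ex_minnP (ex_intro P i Pi)) => i0 Pi0 mini0.
suff : (\sum_(k < n) P k <= minn (n - i0) m)%N by rewrite leq_min => /andP[].
elim: n => [|n IH]; first by rewrite big_ord0.
rewrite big_ord_recr /=; move: IH; rewrite !leq_min => /andP[].
move: (\sum_(k < n) P k)%N => T h1 h2.
case: (boolP (P n)) => [Pn|_]; rewrite ?addn0 ?addn1; last by apply/andP; split; lia.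
by have := mini0 n Pn; have := win i0 n Pi0 Pn; move=> *; apply/andP; split; lia.
Qed.

Lemma fibn_octupling i j : (i + 6 <= j)%N -> (8 * fibn i <= fibn j)%N.
Proof.
have mono : {homo fibn : m n / (m <= n)%N}.
  by apply: homo_leq => //; [exact: leq_trans|exact: fibn_le].
move=> /mono; apply: leq_trans; rewrite !addnS addn0.
apply: leq_trans (fibn_doubling _); rewrite -[8%N]/(2 * 4)%N -mulnA leq_mul2l; apply/orP; right.
apply: leq_trans (fibn_doubling _); rewrite -[4%N]/(2 * 2)%N -mulnA leq_mul2l; apply/orP; right.
exact: fibn_doubling.
Qed.

Section Cone.
Variables (R : realType) (delta : R) (e : R[i] -> R[i]).
Hypothesis delta_small : delta <= 1 / (100 * 100).
Hypothesis he : admissible delta e.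
Implicit Types w : R[i].

Let delta8 : delta <= 1 / 8. Proof. by have := delta_small; lra. Qed.

Let delta0 : 0 <= delta := le_trans (normc_ge0 _) (adm_bound he 0).

Definition odiff w1 w2 n : R[i] := orb e w1 n - orb e w2 n.
Definition ediff w1 w2 n : R[i] := e (sarg e w1 n) - e (sarg e w2 n).

Lemma odiffSS w1 w2 n :
  odiff w1 w2 n.+2 = odiff w1 w2 n.+1 + odiff w1 w2 n + ediff w1 w2 n.
Proof. by rewrite /odiff /ediff !orbSS; ring. Qed.

Lemma sargB w1 w2 n : sarg e w1 n - sarg e w2 n = odiff w1 w2 n.+1 + odiff w1 w2 n.
Proof. by rewrite /sarg /odiff; ring. Qed.

Lemma ler_ediff w1 w2 n :
  normc (ediff w1 w2 n) <= delta * normc (odiff w1 w2 n.+1 + odiff w1 w2 n).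
Proof. by rewrite -sargB; exact: adm_lip he _ _. Qed.

(* The quotients D_(n+1) / D_n stay in the disk of center 8/5, radius 3/5. *)
Lemma odiff_cone w1 w2 n :
  normc (5 * odiff w1 w2 n.+1 - 8 * odiff w1 w2 n) <= 3 * normc (odiff w1 w2 n) /\
  normc (5 * odiff w1 w2 n.+2 - 8 * odiff w1 w2 n.+1) <=
    21 / 10 * normc (odiff w1 w2 n.+1).
Proof.
(* Unperturbed quotients follow q -> 1 + 1 / q, which maps the disk into the one of radius 2 / 5
   about the same centre; the perturbation enlarges this to at most 21 / 50. *)
have step m :
    normc (5 * odiff w1 w2 m.+1 - 8 * odiff w1 w2 m) <= 3 * normc (odiff w1 w2 m) ->
    normc (5 * odiff w1 w2 m.+2 - 8 * odiff w1 w2 m.+1) <=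
      21 / 10 * normc (odiff w1 w2 m.+1).
  set d := odiff w1 w2 m; set d1 := odiff w1 w2 m.+1 => h.
  have := ler_ediff w1 w2 m; have := odiffSS w1 w2 m; rewrite -/d -/d1.
  set d2 := odiff w1 w2 m.+2; set E := ediff w1 w2 m => d2E hE.
  have n5 (x : R[i]) : normc (5 * x) = 5 * normc x by rewrite normcM normc_nat.
  have n8 (x : R[i]) : normc (8 * x) = 8 * normc x by rewrite normcM normc_nat.
  have n3 (x : R[i]) : normc (3 * x) = 3 * normc x by rewrite normcM normc_nat.
  have n25 (x : R[i]) : normc (25 * x) = 25 * normc x by rewrite normcM normc_nat.
  have l1 : normc d <= normc d1.
    have := lerB_normc (8 * d) (8 * d - 5 * d1); rewrite normcBC in h.
    by rewrite subKr n5 n8; lra.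
  have l2 : normc (d1 + d) <= 32 / 10 * normc d.
    have := ler_normcD (5 * d1 - 8 * d) (8 * d); rewrite subrK n5 n8.
    by have := ler_normcD d1 d; lra.
  have E1 : normc E <= 1 / 1000 * normc d.
    have := normc_ge0 d => q0; apply: (le_trans hE).
    apply: (@le_trans _ _ (1 / (100 * 100) * normc (d1 + d))).
      by rewrite ler_wpM2r ?normc_ge0.
    by lra.
  have := ler_normcD (d - 3 * (5 * d1 - 8 * d)) (25 * E).
  have -> : d - 3 * (5 * d1 - 8 * d) + 25 * E = 5 * (5 * d2 - 8 * d1).
    by rewrite d2E; ring.
  have := ler_normcB d (3 * (5 * d1 - 8 * d)).
  by rewrite n25 n3 n5; have := normc_ge0 d; lra.
suff h : normc (5 * odiff w1 w2 n.+1 - 8 * odiff w1 w2 n) <= 3 * normc (odiff w1 w2 n).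
  by split=> //; exact: step.
elim: n => [|n IH]; last by apply: (le_trans (step _ IH)); have := normc_ge0 (odiff w1 w2 n.+1); lra.
(* The initial quotient 1 is a boundary point of the disk, which explains the radius 3 / 5. *)
rewrite [odiff w1 w2 1]/(odiff w1 w2 0) -mulrBl normcM.
have -> : 5 - 8 = - 3%:R :> R[i] by ring.
by rewrite normcNE normc_nat.
Qed.

Lemma odiff_growth w1 w2 n :
  [/\ normc (odiff w1 w2 n) <= normc (odiff w1 w2 n.+1),
      normc (odiff w1 w2 n.+1) <= 22 / 10 * normc (odiff w1 w2 n) &
      118 / 100 * normc (odiff w1 w2 n.+1) <= normc (odiff w1 w2 n.+2)].
Proof.
have [h k] := odiff_cone w1 w2 n.
have n5 (x : R[i]) : normc (5 * x) = 5 * normc x by rewrite normcM normc_nat.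
have n8 (x : R[i]) : normc (8 * x) = 8 * normc x by rewrite normcM normc_nat.
set d := odiff w1 w2 n in h *; set d1 := odiff w1 w2 n.+1 in h k *.
set d2 := odiff w1 w2 n.+2 in k *; split.
- have := lerB_normc (8 * d) (8 * d - 5 * d1); rewrite normcBC in h.
  by rewrite subKr n5 n8; lra.
- by have := ler_normcD (5 * d1 - 8 * d) (8 * d); rewrite subrK n5 n8; lra.
- have := lerB_normc (8 * d1) (8 * d1 - 5 * d2); rewrite normcBC in k.
  by rewrite subKr n5 n8; lra.
Qed.

(** The one-step bounds of [odiff_growth] multiply only to 118 / 100. But 1 + q lies in the disk of
    centre 13 / 5 and radius 3 / 5, so two steps gain almost the factor 2 on which the contraction
    in [A_step] rests. *)
Lemma odiff_double w1 w2 n :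
  99 / 50 * normc (odiff w1 w2 n) <= normc (odiff w1 w2 n.+2) /\
  normc (odiff w1 w2 n.+1 + odiff w1 w2 n) <= 101 / 100 * normc (odiff w1 w2 n.+2).
Proof.
have [h _] := odiff_cone w1 w2 n; have [_ l _] := odiff_growth w1 w2 n.
have := ler_ediff w1 w2 n; have := odiffSS w1 w2 n.
set d := odiff w1 w2 n in h l *; set d1 := odiff w1 w2 n.+1 in h l *.
set d2 := odiff w1 w2 n.+2; set E := ediff w1 w2 n => d2E hE.
have n5 (x : R[i]) : normc (5 * x) = 5 * normc x by rewrite normcM normc_nat.
have n13 (x : R[i]) : normc (13 * x) = 13 * normc x by rewrite normcM normc_nat.
have hE' : normc E <= 1 / (100 * 100) * normc (d1 + d).
  by apply: (le_trans hE); rewrite ler_wpM2r ?normc_ge0.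
have := normc_ge0 d => q0.
split; last first.
  by have := lerB_normcD (d1 + d) E; rewrite -d2E; have := normc_ge0 (d1 + d); lra.
have E1 : normc E <= 1 / 100 * normc d.
  by have := ler_normcD d1 d; lra.
have := lerB_normcD (13 * d) ((5 * d1 - 8 * d) + 5 * E).
have -> : 13 * d + ((5 * d1 - 8 * d) + 5 * E) = 5 * d2 by rewrite d2E; ring.
have := ler_normcD (5 * d1 - 8 * d) (5 * E).
by rewrite !n5 n13; lra.
Qed.

Lemma odiff_linear w1 w2 n :
  (1 + 18 / 100 * n%:R) * normc (w1 - w2) <= normc (odiff w1 w2 n.+1).
Proof.
elim: n => [|n IH]; first by rewrite mulr0 addr0 mul1r.
have [_ _ g] := odiff_growth w1 w2 n; have := normc_ge0 (w1 - w2).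
by rewrite -natr1; have : 0 <= n%:R :> R by []; nra.
Qed.

Lemma odiff_exp w1 w2 n : normc (odiff w1 w2 n) <= 3 ^+ n * normc (w1 - w2).
Proof.
elim: n => [|n IH]; first by rewrite expr0 mul1r.
by have [_ g _] := odiff_growth w1 w2 n; rewrite exprS; have := normc_ge0 (odiff w1 w2 n); lra.
Qed.

Lemma odiff_shadow w1 w2 y1 y2 n : shadow e w1 y1 -> shadow e w2 y2 ->
  `|normc (odiff w1 w2 n) - (fibn n)%:R * normc (y1 - y2)| <= 4 * delta.
Proof.
move=> s1 s2; rewrite -(normc_nat R (fibn n)) -normcM.
have b1 := shadow_bound he s1 n; have b2 := shadow_bound he s2 n.
set f := (fibn n)%:R in b1 b2 *.
have b : normc (odiff w1 w2 n - f * (y1 - y2)) <= 4 * delta.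
  have -> : odiff w1 w2 n - f * (y1 - y2) =
    (orb e w1 n - f * y1) - (orb e w2 n - f * y2) by rewrite /odiff; ring.
  by have := ler_normcB (orb e w1 n - f * y1) (orb e w2 n - f * y2); lra.
have := lerB_normc (odiff w1 w2 n) (f * (y1 - y2)).
have := lerB_normc (f * (y1 - y2)) (odiff w1 w2 n); rewrite normcBC.
by move=> *; rewrite ler_norml; apply/andP; split; lra.
Qed.

(** At a fixed time [n] with n eta > 2, shadows at distance eta would put the orbits more than 1
    apart, while initial values within 3 ^ (- n) keep them closer than 1. *)
Lemma Phi_uniform_cont eta : 0 < eta -> exists2 r : R, 0 < r &
  forall w1 w2 y1 y2, shadow e w1 y1 -> shadow e w2 y2 ->
    normc (w1 - w2) < r -> normc (y1 - y2) < eta.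
Proof.
move=> eta0; pose n := Num.bound (2 / eta).
have : 2 / eta < n%:R by apply: archi_boundP; rewrite divr_ge0 // ltW.
rewrite ltr_pdivrMr // => hn.
exists (3 ^+ n)^-1; first by rewrite invr_gt0 exprn_gt0.
move=> w1 w2 y1 y2 s1 s2; rewrite -[(3 ^+ n)^-1]div1r ltr_pdivlMr ?exprn_gt0 //.
move=> h; have := odiff_shadow n s1 s2; rewrite ler_norml => /andP[h1 _].
have h3 := odiff_exp w1 w2 n; rewrite ltNge; apply/negP => h2.
have : n%:R * eta <= (fibn n)%:R * normc (y1 - y2).
  by rewrite ler_pM // ?ler_nat ?leq_fibn // ltW.
by have := delta_small; lra.
Qed.

Lemma Psi_uniform_cont eta : 0 < eta -> exists2 r : R, 0 < r &
  forall w1 w2 y1 y2, shadow e w1 y1 -> shadow e w2 y2 ->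
    normc (y1 - y2) < r -> normc (w1 - w2) < eta.
Proof.
move=> eta0; pose n := Num.bound (10 / eta).
have : 10 / eta < n%:R by apply: archi_boundP; rewrite divr_ge0 // ltW.
rewrite ltr_pdivrMr // => hn.
have f0 : 0 < (fibn n.+1)%:R :> R by rewrite ltr0n fibn_gt0.
exists (1 / 2 / (fibn n.+1)%:R); first by rewrite !divr_gt0.
move=> w1 w2 y1 y2 s1 s2; rewrite ltr_pdivlMr // => h.
have := odiff_shadow n.+1 s1 s2; rewrite ler_norml => /andP[_ h1].
have h3 := odiff_linear w1 w2 n; rewrite ltNge; apply/negP => h2.
have : 18 / 100 * n%:R * eta <= (1 + 18 / 100 * n%:R) * normc (w1 - w2).
  by have : 0 <= n%:R :> R by []; have := normc_ge0 (w1 - w2); nra.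
by have := delta_small; lra.
Qed.

(** As [e] is [delta]-Lipschitz, testing the expansion at s + 1 / 2 bounds the slope. *)
Lemma conformal_slope s : `|Re s| <= 1 / 2 \/ 3 <= `|Re s| ->
  exists2 mu, normc mu <= 2 * delta & forall t, normc (t - s) <= 1 / 2 ->
      normc (e t - e s - mu * (t - s)) <= delta * normc (t - s) ^+ 2.
Proof.
move=> /(adm_conformal he)[mu hmu]; exists mu => //.
pose t := s + 2^-1; have ts : t - s = 2^-1 by rewrite /t addrC addKr.
have n2 : normc (2^-1 : R[i]) = 1 / 2 by rewrite normcV normc_nat div1r.
have := hmu t; rewrite ts n2 => /(_ (lexx _)) h1.
have := adm_lip he t s; rewrite ts n2 => h2.
have := lerB_normc (mu * 2^-1) (mu * 2^-1 - (e t - e s)).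
rewrite subKr normcM n2 (normcBC (mu * _)) => h3.
by have := delta0; rewrite expr2 in h1; lra.
Qed.

End Cone.

Section Distortion.
Variables (R : realType) (delta : R) (e : R[i] -> R[i]).
Hypothesis delta_small : delta <= 1 / (100 * 100).
Hypothesis he : admissible delta e.
Variables w1 w2 w3 : R[i].
Hypothesis w12 : w1 != w2.

Let delta8 : delta <= 1 / 8. Proof. by have := delta_small; lra. Qed.
Let delta0 : 0 <= delta := le_trans (normc_ge0 _) (adm_bound he 0).

(** [D] and [E] are differences from the same orbit, so that one derivative serves both; [Q] is the
    shape of the triangle of the three points at time [n]. Its first increment vanishes because the
    first two entries of each orbit agree, and for a zero perturbation [Q] would be constant. *)
Let D n := odiff e w1 w2 n.
Let E n := odiff e w1 w3 n.
Let Q n := E n / D n.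
Let A n := normc (Q n.+1 - Q n).
Let bad n := ~~ ((`|Re (sarg e w1 n)| <= 1 / 2) || (3 <= `|Re (sarg e w1 n)|)).

Let D_gt0 n : 0 < normc (D n).
Proof.
have w0 : 0 < normc (w1 - w2) by rewrite normc_gt0 subr_eq0.
case: n => [//|n]; apply: (lt_le_trans _ (odiff_linear delta_small he w1 w2 n)).
by rewrite mulr_gt0 // ltr_pwDl // mulr_ge0 //; lra.
Qed.

Let D_neq0 n : D n != 0. Proof. by rewrite -normc_gt0 D_gt0. Qed.

Let EQ n : E n = Q n * D n. Proof. by rewrite /Q divfK // D_neq0. Qed.

(** The linear part multiplies the increment of [Q] by - D n / D n.+2, of modulus at most 50 / 99 by
    [odiff_double]. *)
Let Q_step n : D n.+2 * (Q n.+2 - Q n.+1) =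
  - (D n * (Q n.+1 - Q n)) + (ediff e w1 w3 n - Q n.+1 * ediff e w1 w2 n).
Proof.
have hE : E n.+2 = E n.+1 + E n + ediff e w1 w3 n by exact: odiffSS.
have hD : D n.+2 = D n.+1 + D n + ediff e w1 w2 n by exact: odiffSS.
by rewrite mulrBr (mulrC _ (Q n.+2)) -EQ hE hD (EQ n.+1) (EQ n); ring.
Qed.

(** In the strips only the Lipschitz bound is available, at the cost of [delta] per visit. Elsewhere
    the terms linear in [mu] cancel up to a multiple of the increment of [Q], and the quadratic
    remainders carry an additional factor |D n.+2|. The smallness hypotheses keep the points within
    the radius 1 / 2 of the expansion. *)
Let err_bound n : normc (D n.+2) <= 1 / 4 -> normc (Q n.+1) <= 1 -> normc (Q n) <= 1 ->
  normc (ediff e w1 w3 n - Q n.+1 * ediff e w1 w2 n) <=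
  4 * delta * normc (D n) * A n +
  4 * delta * (normc (D n.+2) + (bad n)%:R) * normc (Q n.+1) * normc (D n.+2).
Proof.
move=> D4 Q1 Q0.
have [g1 _ _] := odiff_growth delta_small he w1 w2 n.
have [_ _ g2] := odiff_growth delta_small he w1 w2 n.
have [_ dd] := odiff_double delta_small he w1 w2 n.
rewrite -/(D n) -/(D n.+1) -/(D n.+2) in g1 g2 dd.
have sE : E n.+1 + E n = Q n.+1 * (D n.+1 + D n) - D n * (Q n.+1 - Q n).
  by rewrite !EQ; ring.
have nQ := normc_ge0 (Q n.+1); have nD := normc_ge0 (D n); have nA := normc_ge0 (Q n.+1 - Q n).
rewrite -/(A n) in nA; have nD2 := normc_ge0 (D n.+2).
have QD0 := mulr_ge0 nQ nD2; have DA0 := mulr_ge0 nD nA.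
set sDn := normc (D n.+1 + D n) in dd.
have QsD : normc (Q n.+1) * sDn <= 101 / 100 * (normc (Q n.+1) * normc (D n.+2)).
  by have := ler_wpM2l nQ dd; lra.
have sE1 : normc (E n.+1 + E n) <= normc (Q n.+1) * sDn + normc (D n) * A n.
  by rewrite sE (le_trans (ler_normcB _ _)) // (normcM (Q n.+1)) (normcM (D n)).
have sE2 : normc (E n.+1 + E n) <= 2 * normc (D n.+2).
  have := ler_normcD (E n.+1) (E n).
  rewrite !EQ (normcM (Q n.+1)) (normcM (Q n)).
  have := ler_wpM2r (normc_ge0 (D n.+1)) Q1; have := ler_wpM2r nD Q0; lra.
have [nb|/negPn cf] := boolP (bad n).
  have h1 : normc (ediff e w1 w3 n) <= delta * normc (E n.+1 + E n).
    exact: ler_ediff.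
  have h2 : normc (ediff e w1 w2 n) <= delta * sDn by exact: ler_ediff.
  apply: (le_trans (ler_normcB _ _)); rewrite (normcM (Q n.+1)).
  have h3 := ler_wpM2l nQ h2; have h4 := ler_wpM2l delta0 sE1.
  have h5 := ler_wpM2l delta0 QsD.
  have h6 := mulr_ge0 delta0 QD0; have h7 := mulr_ge0 delta0 DA0.
  have h8 := mulr_ge0 h6 nD2.
  by rewrite /=; lra.
have /(conformal_slope he)[mu mu2 hmu] :
    `|Re (sarg e w1 n)| <= 1 / 2 \/ 3 <= `|Re (sarg e w1 n)| by apply/orP.
have k1 : normc (ediff e w1 w2 n - mu * (D n.+1 + D n)) <= delta * sDn ^+ 2.
  have hB : sarg e w2 n - sarg e w1 n = - (D n.+1 + D n) by rewrite -opprB sargB.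
  have := hmu (sarg e w2 n); rewrite hB normcNE -/sDn => h.
  rewrite -normcNE; have -> : - (ediff e w1 w2 n - mu * (D n.+1 + D n)) =
    e (sarg e w2 n) - e (sarg e w1 n) - mu * - (D n.+1 + D n) by rewrite /ediff; ring.
  by apply: h; lra.
have k2 : normc (ediff e w1 w3 n - mu * (E n.+1 + E n)) <= delta * normc (E n.+1 + E n) ^+ 2.
  have hB : sarg e w3 n - sarg e w1 n = - (E n.+1 + E n) by rewrite -opprB sargB.
  have := hmu (sarg e w3 n); rewrite hB normcNE => h.
  rewrite -normcNE; have -> : - (ediff e w1 w3 n - mu * (E n.+1 + E n)) =
    e (sarg e w3 n) - e (sarg e w1 n) - mu * - (E n.+1 + E n) by rewrite /ediff; ring.
  by apply: h; lra.
have -> : ediff e w1 w3 n - Q n.+1 * ediff e w1 w2 n =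
  (ediff e w1 w3 n - mu * (E n.+1 + E n)) -
  (Q n.+1 * (ediff e w1 w2 n - mu * (D n.+1 + D n)) + mu * (D n * (Q n.+1 - Q n))).
  by rewrite sE; ring.
apply: (le_trans (ler_normcB _ _)).
have := ler_normcD (Q n.+1 * (ediff e w1 w2 n - mu * (D n.+1 + D n))) (mu * (D n * (Q n.+1 - Q n))).
rewrite (normcM (Q n.+1)) (normcM mu) (normcM (D n)) -/(A n) => tri.
have m1 := ler_wpM2r DA0 mu2.
have m2 := ler_wpM2l nQ k1.
have m3 : normc (Q n.+1) * sDn ^+ 2 <= 103 / 100 * (normc (Q n.+1) * normc (D n.+2) * normc (D n.+2)).
  have s0 : 0 <= sDn by exact: normc_ge0.
  have -> : normc (Q n.+1) * sDn ^+ 2 = (normc (Q n.+1) * sDn) * sDn by ring.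
  have : (normc (Q n.+1) * sDn) * sDn <=
     (101 / 100 * (normc (Q n.+1) * normc (D n.+2))) * (101 / 100 * normc (D n.+2)).
    by rewrite ler_pM // mulr_ge0.
  by have := mulr_ge0 QD0 nD2; lra.
have m4 : normc (E n.+1 + E n) ^+ 2 <=
  203 / 100 * (normc (Q n.+1) * normc (D n.+2) * normc (D n.+2)) + 2 * (normc (D n) * A n).
  have : normc (E n.+1 + E n) ^+ 2 <=
     (normc (Q n.+1) * sDn + normc (D n) * A n) * (2 * normc (D n.+2)).
    by rewrite expr2 ler_pM ?normc_ge0.
  have := ler_wpM2r nD2 QsD; have : normc (D n) * A n * normc (D n.+2) <= normc (D n) * A n * 1.
    by rewrite ler_wpM2l //; lra.
  have := mulr_ge0 QD0 nD2; lra.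
have m5 := ler_wpM2l delta0 m4; have m6 := ler_wpM2l delta0 m3.
have m7 := mulr_ge0 delta0 (mulr_ge0 QD0 nD2); have m8 := mulr_ge0 delta0 DA0.
by rewrite /=; lra.
Qed.

Let A_step n : normc (D n.+2) <= 1 / 4 -> normc (Q n.+1) <= 1 -> normc (Q n) <= 1 ->
  A n.+1 <= 6 / 10 * A n + 4 * delta * (normc (D n.+2) + (bad n)%:R) * normc (Q n.+1).
Proof.
move=> D4 Q1 Q0; rewrite -(ler_pM2l (D_gt0 n.+2)) {1}/A -normcM Q_step.
apply: (le_trans (ler_normcD _ _)); rewrite normcNE (normcM (D n)) -/(A n).
have := err_bound D4 Q1 Q0.
have [d2 _] := odiff_double delta_small he w1 w2 n.
rewrite -/(D n) -/(D n.+2) in d2.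
have nA : 0 <= A n := normc_ge0 _; have := ler_wpM2r nA d2.
have := ler_wpM2r (mulr_ge0 (normc_ge0 (D n)) nA) delta_small.
have := mulr_ge0 (normc_ge0 (D n)) nA; lra.
Qed.

Let S n := \sum_(k < n) (normc (D k.+2) + (bad k)%:R).

(** Distances grow by 118 / 100 per step, so their sum is at most 7 times the last one, hence 7 / 4;
    visits to the strips add at most 6. *)
Let S_bound n : normc (D n.+1) <= 1 / 4 -> 0 <= S n <= 8.
Proof.
move=> D4; apply/andP; split.
  by rewrite sumr_ge0 // => k _; rewrite addr_ge0 ?normc_ge0.
rewrite /S big_split /=.
have h1 : \sum_(k < n) normc (D k.+2) <= 7 * normc (D n.+1).
  elim: n {D4} => [|n IH]; first by rewrite big_ord0 mulr_ge0 ?normc_ge0.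
  rewrite big_ord_recr /=; have [_ _] := odiff_growth delta_small he w1 w2 n.
  by rewrite -/(D n.+1) -/(D n.+2); have := normc_ge0 (D n.+2); lra.
have h2 : \sum_(k < n) (bad k)%:R <= 6%:R :> R.
  rewrite -natr_sum ler_nat; apply: sum_window => i j.
  have [y sy] := shadow_ex_target w1 he.
  have near k : `|Re (sarg e w1 k) - (fibn k.+2)%:R * Re y| <= 4 * delta.
    rewrite -Re_natM -ReB (le_trans (ler_normRe _)) //.
    have := shadow_bound he sy k; have := shadow_bound he sy k.+1.
    have := ler_normcD (orb e w1 k.+1 - (fibn k.+1)%:R * y) (orb e w1 k - (fibn k)%:R * y).
    have -> : orb e w1 k.+1 - (fibn k.+1)%:R * y + (orb e w1 k - (fibn k)%:R * y) =
      sarg e w1 k - (fibn k.+2)%:R * y by rewrite /sarg fibnSS natrD; ring.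
    lra.
  (* Widened by the shadowing error, the range 1 / 2 < |Re s| < 3 fits into [4 / 10, 31 / 10], whose
     ends have ratio below 8, while [fibn] grows by 8 in six steps. *)
  have scale k : bad k -> 4 / 10 <= (fibn k.+2)%:R * `|Re y| <= 31 / 10.
    rewrite /bad negb_or -!ltNge => /andP[b1 b2]; have n1 := near k.
    have n2 : `|(fibn k.+2)%:R * Re y| = (fibn k.+2)%:R * `|Re y|.
      by rewrite normrM ger0_norm.
    have := lerB_dist (Re (sarg e w1 k)) ((fibn k.+2)%:R * Re y).
    have := lerB_dist ((fibn k.+2)%:R * Re y) (Re (sarg e w1 k)).
    rewrite (distrC (_ * _)) n2; have := delta_small.
    by move=> *; apply/andP; split; lra.
  move=> /scale/andP[b1 _] /scale/andP[_ b2]; rewrite ltnNge; apply/negP => ij.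
  have : (8 * fibn i.+2 <= fibn j.+2)%N.
    by apply: fibn_octupling; rewrite !addSn !ltnS.
  rewrite -(ler_nat R) natrM => h8.
  by have := ler_wpM2r (normr_ge0 (Re y)) h8; lra.
lra.
Qed.

(** The quantity (|Q| + 3 / 2 A) (1 - 10 delta S) does not increase: the weight solves (1 + 3 / 2) 6
    / 10 = 3 / 2, and 10 is (1 + 3 / 2) 4. As 10 delta S stays below 1 / 2, |Q| at most doubles;
    starting below 1 / 2 it stays below 1, which is what [A_step] needs to continue. *)
Lemma distortion n : (forall k, (k <= n)%N -> normc (D k) <= 1 / 4) ->
  2 * normc (E 0) <= normc (D 0) ->
  normc (E n) * normc (D 0) <= 2 * normc (E 0) * normc (D n).
Proof.
move=> hD hE.
have Q0 : normc (Q 0) <= 1 / 2.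
  by rewrite /Q normcM normcV ler_pdivrMr; [lra|exact: D_gt0].
have V m : (m < n)%N -> [/\ normc (Q m) <= 1, normc (Q m.+1) <= 1 &
    (normc (Q m.+1) + 3 / 2 * A m) * (1 - 10 * delta * S m) <= normc (Q 0)].
  elim: m => [|m IH] mn.
    have Q10 : Q 1 = Q 0 by [].
    rewrite /A Q10 subrr normc0 mulr0 addr0 /S big_ord0 mulr0 subr0 mulr1.
    by split=> //; lra.
  have [q0 q1 v] := IH (ltnW mn).
  have st := A_step (hD _ mn) q1 q0.
  have tri := ler_normcD (Q m.+2 - Q m.+1) (Q m.+1); rewrite subrK -/(A m.+1) in tri.
  have /andP[s0 s8] := S_bound (hD _ (ltnW mn)).
  have /andP[s0' s8'] := S_bound (hD _ mn).
  have SS : S m.+1 = S m + (normc (D m.+2) + (bad m)%:R) by rewrite /S big_ord_recr.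
  set x := normc (D m.+2) + _ in SS st.
  have x0 : 0 <= x by rewrite addr_ge0 ?normc_ge0.
  have nQ := normc_ge0 (Q m.+1); have nA : 0 <= A m := normc_ge0 _.
  have nA' : 0 <= A m.+1 := normc_ge0 _.
  have dx0 := mulr_ge0 delta0 x0.
  have V1 : normc (Q m.+2) + 3 / 2 * A m.+1 <=
      (normc (Q m.+1) + 3 / 2 * A m) * (1 + 10 * delta * x).
    have := mulr_ge0 dx0 nA; lra.
  have dS0 := mulr_ge0 delta0 s0.
  have dS' : delta * S m.+1 <= 1 / 100.
    have := ler_wpM2r s0' delta_small; lra.
  have V2 : (normc (Q m.+2) + 3 / 2 * A m.+1) * (1 - 10 * delta * S m.+1) <= normc (Q 0).
    apply: le_trans v.
    have p1 : 0 <= 1 - 10 * delta * S m.+1 by lra.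
    apply: (le_trans (ler_wpM2r p1 V1)); rewrite -(mulrA (normc (Q m.+1) + _)).
    apply: ler_wpM2l; first by rewrite addr_ge0 // mulr_ge0.
    rewrite SS; have := mulr_ge0 dS0 dx0; have := mulr_ge0 dx0 dx0; lra.
  split => //.
  have p2 : 1 / 2 <= 1 - 10 * delta * S m.+1 by lra.
  have := ler_wpM2l (normc_ge0 (Q m.+2)) p2.
  have p3 : 0 <= 1 - 10 * delta * S m.+1 by lra.
  have := mulr_ge0 (mulr_ge0 (_ : 0 <= 3 / 2) nA') p3; lra.
suff : normc (Q n) <= 2 * normc (Q 0).
  rewrite /Q !normcM !normcV mulrA ler_pdivlMr ?D_gt0 //.
  rewrite mulrAC ler_pdivrMr ?D_gt0 //; lra.
case: n hD V => [|n] hD V; first by have := normc_ge0 (Q 0); lra.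
have [_ _ v] := V n (ltnSn n).
have /andP[s0 s8] := S_bound (hD _ (leqnn n.+1)).
have dS' : delta * S n <= 1 / 100 by have := ler_wpM2r s0 delta_small; lra.
have p2 : 1 / 2 <= 1 - 10 * delta * S n by lra.
have := ler_wpM2l (normc_ge0 (Q n.+1)) p2.
have p3 : 0 <= 1 - 10 * delta * S n by lra.
have nA : 0 <= A n := normc_ge0 _.
have := mulr_ge0 nA p3; lra.
Qed.

End Distortion.

(** If [w3] were more than 200 times closer to [w1] than [w2] is, distortion would keep the ratio
    below 1 / 100 up to the last time [N] when the larger difference is at most 1 / 4. At that scale
    differences are [fibn N] times those of the shadows, up to 4 delta, which contradicts the
    comparison of the latter. *)
Lemma quasisymmetry (R : realType) (delta : R) (e : R[i] -> R[i])
    (w1 w2 w3 y1 y2 y3 : R[i]) :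
  delta <= 1 / (100 * 100) -> admissible delta e ->
  shadow e w1 y1 -> shadow e w2 y2 -> shadow e w3 y3 ->
  normc (w1 - w2) <= 1 / 4 -> normc (y1 - y2) <= 32 * normc (y1 - y3) ->
  normc (w1 - w2) <= 100 * (2 * normc (w1 - w3)).
Proof.
move=> ds he s1 s2 s3 w4 hy; rewrite leNgt; apply/negP => hw.
have w12 : w1 != w2.
  rewrite -subr_eq0 -normc_gt0; apply: le_lt_trans hw.
  by rewrite !mulr_ge0 ?normc_ge0.
have w0 : 0 < normc (w1 - w2) by rewrite normc_gt0 subr_eq0.
have ex : exists n, 1 / 4 < normc (odiff e w1 w2 n).
  pose n := Num.bound (10 / normc (w1 - w2)).
  have : 10 / normc (w1 - w2) < n%:R by apply: archi_boundP; rewrite divr_ge0 // ltW.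
  rewrite ltr_pdivrMr // => hn; exists n.+1.
  by have := odiff_linear ds he w1 w2 n; lra.
have [N N4 minN] := ex_minnP ex.
case: N N4 minN => [|N] N4 minN; first by move: N4; rewrite /odiff /=; lra.
have small k : (k <= N)%N -> normc (odiff e w1 w2 k) <= 1 / 4.
  by move=> kN; rewrite leNgt; apply/negP => /minN; rewrite ltnNge kN.
have [_ g _] := odiff_growth ds he w1 w2 N.
have N9 : 1 / 9 <= normc (odiff e w1 w2 N) by lra.
have := distortion (w3 := w3) ds he w12 small.
rewrite /odiff /= -/(odiff e w1 w2 N) -/(odiff e w1 w3 N) => dist.
have nw3 := normc_ge0 (w1 - w3).
have E1 : normc (odiff e w1 w3 N) <= 1 / 100 * normc (odiff e w1 w2 N).
  have h2 : 2 * normc (w1 - w3) <= normc (w1 - w2) by lra.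
  have := dist h2; rewrite -(ler_pM2r w0); have := normc_ge0 (odiff e w1 w2 N).
  nra.
have := odiff_shadow he N s1 s2; have := odiff_shadow he N s1 s3.
rewrite !ler_norml => /andP[h1 _] /andP[_ h2].
have f0 : 0 <= (fibn N)%:R :> R by [].
(* The contradiction reads 1 / 9 - 4 delta <= 32 (1 / 400 + 4 delta). *)
have := ler_wpM2l f0 hy; have := small N (leqnn N); lra.
Qed.

(** * The filled Julia set in the logarithmic coordinate *)

Lemma normE (R : realType) (z : Cplx R) : `|z| = (normc z)%:C.
Proof. by []. Qed.

Fixpoint hen (R : realType) (c z : R[i]) n : R[i] :=
  match n with
  | 0 => z
  | n1.+1 => match n1 with 0 => z | n2.+1 => hen c z n1 * hen c z n2 + c end
  end.

Lemma henSS (R : realType) (c z : R[i]) n :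
  hen c z n.+2 = hen c z n.+1 * hen c z n + c.
Proof. by []. Qed.

Lemma iter_henon (R : realType) (c z : Cplx R) n :
  iter n (henon c) (z, z) = (hen c z n.+1, hen c z n).
Proof. by elim: n => [//|n IH]; rewrite iterS IH. Qed.

Lemma KdiagP (R : realType) (c z : Cplx R) :
  Kdiag c z <-> exists B : R, forall n, normc (hen c z n) <= B.
Proof.
have maxC (a b : R) : Num.max a%:C b%:C = (Num.max a b)%:C.
  by rewrite /Order.max ltcR; case: ifP.
rewrite /Kdiag /Kplus /bounded_near /= nearE; split.
  move=> [M [Mr hM]]; exists (Re M + 1) => n.
  have Mlt : M < (Re M + 1)%:C by rewrite -{1}(RRe_real Mr) ltcR ltrDl ltr01.
  have /= := hM _ Mlt _ (ex_intro2 _ _ n I (erefl _)).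
  rewrite prod_normE iter_henon /= !normE maxC lecR.
  by rewrite ge_max => /andP[].
move=> [B hB]; exists B%:C; split.
  by apply/complex_realP; exists B.
move=> x Bx _ [n _ <-]; rewrite prod_normE iter_henon /= !normE maxC.
by apply: le_trans (ltW Bx); rewrite lecR ge_max (hB n.+1) hB.
Qed.

Section Trap.
Variables (R : realType) (c : R[i]) (delta : R).
Hypothesis c_small : normc c <= (32 * expR 2)^-1.
Hypothesis delta_small : delta <= 1 / (100 * 100).
Hypothesis adm : admissible delta (eps c).

Local Notation e := (eps c).

Let c90 : normc c <= 1 / 90.
Proof.
have K3 := expR_ge1Dx (2 : R); have K0 : 0 < 32 * expR (2 : R) by lra.
by apply: (le_trans c_small); rewrite -div1r ler_pdivrMr //; lra.
Qed.

Let trapped z m : normc (hen c z m) <= 31 / 32 -> normc (hen c z m.+1) <= 31 / 32 ->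
  forall j, normc (hen c z (m + j)) <= 31 / 32.
Proof.
move=> h0 h1 j; suff : normc (hen c z (m + j)) <= 31 / 32 /\
  normc (hen c z (m + j).+1) <= 31 / 32 by case.
elim: j => [|j [IH0 IH1]]; first by rewrite addn0.
rewrite addnS; split=> //; rewrite henSS.
have := ler_normcD (hen c z (m + j).+1 * hen c z (m + j)) c; rewrite normcM.
have := normc_ge0 (hen c z (m + j)); have := normc_ge0 (hen c z (m + j).+1).
have := c90; nra.
Qed.

(** Once two consecutive moduli exceed 1 by a definite amount, their product outgrows the loss [c];
    gaining 1 / 64 per step is crude but unbounded in total. *)
Let escaping z m : 17 / 16 <= normc (hen c z m) -> 17 / 16 <= normc (hen c z m.+1) ->
  ~ exists B : R, forall n, normc (hen c z n) <= B.
Proof.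
move=> h0 h1.
have grow j : 33 / 32 + 1 / 64 * j%:R <= normc (hen c z (m + j)) /\
    33 / 32 + 1 / 64 * j.+1%:R <= normc (hen c z (m + j).+1).
  elim: j => [|j [IH0 IH1]]; first by rewrite addn0; split; lra.
  rewrite addnS; split=> //; rewrite henSS -natr1.
  apply: le_trans (lerB_normcD _ _); rewrite normcM.
  have j0 : 0 <= j%:R :> R by [].
  move: IH1; rewrite -natr1; have := c90; nra.
move=> [B hB]; pose j := Num.bound (64 * B).
have B0 : 0 <= B := le_trans (normc_ge0 _) (hB 0%N).
have : 64 * B < j%:R by apply: archi_boundP; rewrite mulr_ge0.
by have [h _] := grow j; have := hB (m + j)%N; lra.
Qed.

Lemma Kdiag0 : Kdiag c 0.
Proof.
apply/KdiagP; exists (31 / 32) => n; rewrite -[n]add0n.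
by apply: trapped; rewrite normc0; lra.
Qed.

(** Entry k.+2 is computed from [sarg e w k], so control of the arguments below [m] reaches index
    m.+1. *)
Lemma hen_cexp w m : (forall k, (k < m)%N -> `|Re (sarg e w k)| <= 1) ->
  forall k, (k <= m.+1)%N -> hen c (cexp w) k = cexp (orb e w k).
Proof.
move=> hm; suff P k : ((k <= m.+1)%N -> hen c (cexp w) k = cexp (orb e w k)) /\
  ((k.+1 <= m.+1)%N -> hen c (cexp w) k.+1 = cexp (orb e w k.+1)).
  by move=> k; case: (P k).
elim: k => [|k [IH0 IH1]]; first by [].
split=> // km; rewrite henSS (IH1 (ltnW km)) (IH0 (ltnW (ltnW km))).
have := eps_exp c_small (hm k km).
by rewrite orbSS -/(sarg e w k) => ->; rewrite -cexpD.
Qed.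

(** Stop at the first [m] with fibn (m + 2) |Re y| >= 1 / 2. Until then the arguments stay where the
    logarithmic orbit is the true one. As [fibn] at most doubles per step, the real parts at times m
    and m + 1 are at least 1 / 16 away from 0, on the side of Re y, and these two moduli decide
    between [trapped] and [escaping]. If Re y = 0 the orbit never leaves the strip. *)
Lemma Kdiag_cexp w y : shadow e w y -> Kdiag c (cexp w) <-> Re y <= 0.
Proof.
move=> sw; have near k : `|Re (orb e w k) - (fibn k)%:R * Re y| <= 2 * delta.
  by rewrite -Re_natM -ReB (le_trans (ler_normRe _)) // (shadow_bound adm sw).
have nears k : `|Re (sarg e w k) - (fibn k.+2)%:R * Re y| <= 4 * delta.
  have := near k; have := near k.+1; rewrite fibnSS natrD ReD !ler_norml.
  by move=> /andP[? ?] /andP[? ?]; apply/andP; split; lra.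
have [y0|y0] := eqVneq (Re y) 0.
  split=> [_|_]; first by rewrite y0.
  apply/KdiagP; exists (expR 1) => n.
  rewrite (@hen_cexp w n) //.
    rewrite normc_cexp ler_expR; have := near n.
    by rewrite y0 mulr0 subr0 ler_norml => /andP[_]; have := delta_small; lra.
  by move=> k _; have := nears k; rewrite y0 mulr0 subr0; have := delta_small; lra.
have u0 : 0 < `|Re y| by rewrite normr_gt0.
have ex : exists m, 1 / 2 <= (fibn m.+2)%:R * `|Re y|.
  pose m := Num.bound (`|Re y|^-1); exists m.
  have : `|Re y|^-1 < m%:R by apply: archi_boundP; rewrite invr_ge0.
  rewrite -div1r ltr_pdivrMr // => h.
  have : m%:R <= (fibn m.+2)%:R :> R by rewrite ler_nat; apply: leq_trans (leq_fibn m.+2); exact: (leq_addl 2 m).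
  by move/(ler_wpM2r (ltW u0)); lra.
have [m hm minm] := ex_minnP ex.
have before k : (k < m)%N -> `|Re (sarg e w k)| <= 1.
  move=> km; have : (fibn k.+2)%:R * `|Re y| < 1 / 2.
    by rewrite ltNge; apply/negP => /minm; rewrite leqNgt km.
  have := lerB_dist (Re (sarg e w k)) ((fibn k.+2)%:R * Re y).
  rewrite normrM [`|_%:R|]ger0_norm //.
  by have := nears k; have := delta_small; lra.
have H := hen_cexp before.
have f1 : 1 / 4 <= (fibn m.+1)%:R * `|Re y|.
  have := fibnS_le m.+1; rewrite -(ler_nat R) natrM => /(ler_wpM2r (ltW u0)).
  lra.
have f0 : 1 / 8 <= (fibn m)%:R * `|Re y|.
  have := fibnS_le m; rewrite -(ler_nat R) natrM => /(ler_wpM2r (ltW u0)).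
  lra.
have n0 := near m; have n1 := near m.+1; rewrite !ler_norml in n0 n1.
have ds : delta <= 1 / 100 by have := delta_small; lra.
have [yn|yp] := lerP (Re y) 0.
  split=> // _; apply/KdiagP; exists (expR 1) => n.
  rewrite (ler0_norm yn) in f0 f1.
  have e16 : expR (- (1 / 16)) <= 31 / 32 :> R.
    rewrite expRN -div1r ler_pdivrMr ?expR_gt0 //.
    by have := expR_ge1Dx (1 / 16 : R); lra.
  have t0 : normc (hen c (cexp w) m) <= 31 / 32.
    rewrite H // normc_cexp; apply: le_trans e16; rewrite ler_expR.
    by case/andP: n0; lra.
  have t1 : normc (hen c (cexp w) m.+1) <= 31 / 32.
    rewrite H // normc_cexp; apply: le_trans e16; rewrite ler_expR.
    by case/andP: n1; lra.
  have [nm|nm] := leqP n m.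
    rewrite H ?(leqW nm) // normc_cexp ler_expR; have := near n.
    have : 0 <= (fibn n)%:R :> R by [].
    by rewrite ler_norml => h /andP[_ h']; nra.
  have := trapped t0 t1 (n - m); rewrite subnKC; last exact: ltnW.
  by have := expR_ge1Dx (1 : R); lra.
split=> [/KdiagP K|//].
rewrite (gtr0_norm yp) in f0 f1.
have e16 : 17 / 16 <= expR (1 / 16) :> R by have := expR_ge1Dx (1 / 16 : R); lra.
case: (@escaping (cexp w) m) => //.
  rewrite H // normc_cexp; apply: (le_trans e16); rewrite ler_expR.
  by case/andP: n0; lra.
rewrite H // normc_cexp; apply: (le_trans e16); rewrite ler_expR.
by case/andP: n1; lra.
Qed.

End Trap.

(** * Topology of the plane and of the sphere *)

(** Library balls have radii in [R[i]]; a positive element of [R[i]] is real, so real radii describe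
    the same neighbourhoods. *)
Lemma nbhs_CplxP (R : realType) (z : Cplx R) (A : set (Cplx R)) :
  nbhs z A <-> exists2 r : R, 0 < r & forall x, normc (z - x) < r -> A x.
Proof.
split.
  move=> /nbhs_ballP [r /= r0 hr]; exists (Re r).
    by move: r0; rewrite ltcE /= => /andP[].
  move=> x hx; apply: hr; rewrite -ball_normE /=.
  have rr : r = (Re r)%:C.
    by rewrite RRe_real // realE (ltW r0).
  by rewrite rr -[`|_|]/((normc (z - x))%:C) ltcR.
move=> [r r0 hr]; apply/nbhs_ballP; exists r%:C => /=; first by rewrite ltcR.
by move=> x; rewrite -ball_normE /= -[`|_|]/((normc (z - x))%:C) ltcR => /hr.
Qed.

Definition cball (R : realType) (M : R) : set (Cplx R) := [set x | normc x <= M].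

Lemma closed_cball (R : realType) (M : R) : closed (cball M).
Proof.
rewrite -openC openE => x /= /negP; rewrite -ltNge => hx.
apply/nbhs_CplxP; exists (normc x - M); first by rewrite subr_gt0.
move=> y hy /=; apply/negP; rewrite -ltNge.
by have := lerB_normc x (x - y); rewrite subKr; lra.
Qed.

Lemma compact_cball (R : realType) (M : R) : compact (cball M).
Proof.
pose f (p : R * R) : Cplx R := p.1 +i* p.2.
have fc : continuous f.
  move=> [a b] A /nbhs_CplxP [r r0 hr].
  exists (ball a (r / 2), ball b (r / 2)) => /=.
    by split; apply: nbhsx_ballx; rewrite divr_gt0.
  move=> [a' b'] /= [ha hb]; apply: hr.
  apply: (le_lt_trans (normc_le_ReIm _)); rewrite ReB ImB /=.
  by move: ha hb; rewrite -!ball_normE /=; lra.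
have K := @compact_setX R R _ _ (@segment_compact R (- M) M) (@segment_compact R (- M) M).
have fK := continuous_compact (continuous_subspaceT fc) K.
apply: (subclosed_compact (@closed_cball R M) fK).
move=> [a b] hab; exists (a, b) => //=; split; rewrite /= in_itv /= -ler_norml.
  exact: le_trans (ler_normRe (a +i* b)) hab.
exact: le_trans (ler_normIm (a +i* b)) hab.
Qed.

Lemma compact_normc_bounded (R : realType) (K : set (Cplx R)) : compact K ->
  exists M : R, forall x, K x -> normc x <= M.
Proof.
move=> cK; have nc : continuous (@normc R : Cplx R -> R^o).
  move=> z A /nbhs_ballP [r /= r0 hr]; apply/nbhs_CplxP; exists r => // x hx.
  apply: hr; rewrite -ball_normE /=; apply: le_lt_trans hx.
  rewrite ler_norml; have := lerB_normc z x; have := lerB_normc x z.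
  by rewrite (normcBC x z); move=> *; apply/andP; split; lra.
have /compact_bounded [M [_ hM]] := continuous_compact (continuous_subspaceT nc) cK.
exists (M + 1) => x Kx.
have M1 : M < M + 1 by rewrite ltrDl.
have := hM (M + 1) M1 (normc x) (ex_intro2 _ _ x Kx (erefl _)).
by rewrite /= ger0_norm // normc_ge0.
Qed.

(** * The chordal metric and the linear dilatation *)

Definition jap (R : realType) (z : R[i]) : R := Num.sqrt (1 + normc z ^+ 2).

Section Jap.
Variable R : realType.
Implicit Types z x : R[i].

Lemma jap_sqr z : jap z ^+ 2 = 1 + normc z ^+ 2.
Proof. by rewrite /jap sqr_sqrtr // addr_ge0 ?sqr_ge0. Qed.

Lemma jap_ge1 z : 1 <= jap z.
Proof.
by rewrite -(sqrtr1 R) /jap ler_wsqrtr // lerDl sqr_ge0.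
Qed.

Lemma jap_gt0 z : 0 < jap z. Proof. exact: lt_le_trans ltr01 (jap_ge1 z). Qed.

Lemma normc_le_jap z : normc z <= jap z.
Proof.
by have := jap_sqr z; have := jap_gt0 z; have := normc_ge0 z; nra.
Qed.

Lemma jap_le z : jap z <= 1 + normc z.
Proof.
by have := jap_sqr z; have := jap_gt0 z; have := normc_ge0 z; nra.
Qed.

Lemma jap_lip z x : `|jap z - jap x| <= normc (z - x).
Proof.
have h : (jap z - jap x) * (jap z + jap x) = (normc z - normc x) * (normc z + normc x).
  by rewrite -!subr_sqr !jap_sqr; ring.
have s0 : 0 < jap z + jap x by rewrite addr_gt0 ?jap_gt0.
rewrite -(ler_pM2r s0) -[X in _ * X <= _](gtr0_norm s0) -normrM h normrM.
rewrite [X in _ * X <= _]ger0_norm ?addr_ge0 ?normc_ge0 // ler_pM ?addr_ge0 ?normc_ge0 //.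
  rewrite ler_norml; have := lerB_normc z x; have := lerB_normc x z.
  by rewrite (normcBC x z); move=> *; apply/andP; split; lra.
by rewrite lerD ?normc_le_jap.
Qed.

End Jap.

Section Chordal.
Variable R : realType.
Implicit Types z x : Cplx R.

Lemma chordal_some z x :
  @chordal R (Some z) (Some x) = 2 * normc (z - x) / (jap z * jap x).
Proof. by []. Qed.

Lemma chordal_ge0 (p q : sphere R) : 0 <= chordal p q.
Proof.
case: p q => [z|] [x|] //=; rewrite ?divr_ge0 ?mulr_ge0 ?normc_ge0 ?sqrtr_ge0 //.
Qed.

Lemma chordal_self (p : sphere R) : chordal p p = 0.
Proof. by case: p => [z|] //=; rewrite subrr normc0 mulr0 mul0r. Qed.

(** [jap] is 1-Lipschitz and at least 1, so within distance 1 / 2 it changes by a factor between 1 /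
    2 and 3 / 2. *)
Lemma chordal_close z x : normc (z - x) <= 1 / 2 ->
  4 / 3 * (normc (z - x) / jap z ^+ 2) <= @chordal R (Some z) (Some x) <=
  4 * (normc (z - x) / jap z ^+ 2).
Proof.
move=> h; rewrite chordal_some; have j0 := jap_gt0 z; have j1 := jap_gt0 x.
have := jap_lip z x; rewrite ler_norml => /andP[l1 l2]; have z1 := jap_ge1 z.
have n0 := normc_ge0 (z - x).
have e1 : 4 / 3 * (normc (z - x) / jap z ^+ 2) =
    2 * normc (z - x) / (jap z * (3 / 2 * jap z)) by field; lra.
have e2 : 4 * (normc (z - x) / jap z ^+ 2) =
    2 * normc (z - x) / (jap z * (1 / 2 * jap z)) by field; lra.
rewrite e1 e2; apply/andP; split; apply: ler_wpM2l; rewrite ?mulr_ge0 //.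
  rewrite lef_pV2 ?posrE ?mulr_gt0 //; try lra.
  by rewrite ler_pM2l //; lra.
rewrite lef_pV2 ?posrE ?mulr_gt0 //; try lra.
by rewrite ler_pM2l //; lra.
Qed.

Lemma nbhs_chordal (p : sphere R) (r : R) : 0 < r -> nbhs p [set q | chordal p q < r].
Proof.
case: p => [z|] r0.
  suff : nbhs z [set x : Cplx R | @chordal R (Some z) (Some x) < r] by [].
  apply/nbhs_CplxP; exists (r / 2); first by rewrite divr_gt0.
  move=> x hx; rewrite /= -/(jap z) -/(jap x).
  rewrite ltr_pdivrMr ?mulr_gt0 ?jap_gt0 //; have := jap_ge1 z; have := jap_ge1 x.
  move=> h1 h2; have h3 : 1 <= jap z * jap x by nra.
  by have := normc_ge0 (z - x); nra.
exists (cball (2 / r)); first by split; [exact: compact_cball|exact: closed_cball].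
move=> [x|] /=; last by [].
case=> [[y hy [<-]]|//] /=; rewrite -/(jap y).
rewrite ltr_pdivrMr ?jap_gt0 //; move/negP: hy; rewrite -ltNge ltr_pdivrMr // => hy.
by have := normc_le_jap y; nra.
Qed.

Lemma chordal_nbhs (p : sphere R) (A : set (sphere R)) : nbhs p A ->
  exists2 m : R, 0 < m & forall q, chordal p q < m -> A q.
Proof.
case: p => [z|].
  move=> /nbhs_CplxP [r r0 hr]; pose Z := jap z.
  have Z0 : 0 < Z := jap_gt0 z.
  (* 2 / Z is the distance from [z] to infinity, which is thereby excluded. Since jap x <= Z + |z -
     x| and u / (Z + u) increases with u, the second term bounds below the chordal distance to
     points with |z - x| >= r. *)
  pose m := Num.min (2 / Z) (2 * r / (Z * (Z + r))).
  have m0 : 0 < m.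
    by rewrite lt_min !divr_gt0 ?mulr_gt0 ?addr_gt0.
  exists m => // -[x|]; rewrite lt_min => /andP[h1 h2]; last first.
    by move: h1; rewrite /= -/(jap z) ltxx.
  apply: hr; rewrite ltNge; apply/negP => rx.
  move: h2; rewrite ltNge => /negP; apply.
  rewrite chordal_some -/Z; have jx : jap x <= Z + normc (z - x).
    by have := jap_lip z x; rewrite ler_norml => /andP[]; rewrite -/Z; lra.
  have j0 := jap_gt0 x.
  rewrite ler_pdivrMr ?mulr_gt0 ?addr_gt0 // mulrAC ler_pdivlMr ?mulr_gt0 //.
  have : r * jap x <= normc (z - x) * (Z + r) by nra.
  by move/(ler_wpM2l (ltW Z0)); lra.
move=> [K [cK _] hK]; have [M hM] := compact_normc_bounded cK.
exists (2 / (1 + `|M|)); first by rewrite divr_gt0 // ltr_pwDl.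
move=> [x|] /= h; last by apply: hK; right.
apply: hK; left; exists x => // Kx.
move: h; rewrite -/(jap x) ltr_pM2l // ltf_pV2 ?posrE ?jap_gt0 ?ltr_pwDl //.
by have := jap_le x; have := hM x Kx; have := ler_norm M; lra.
Qed.

(* Points [q'] outside a fixed neighbourhood of [p] are harmless, since [f]
   keeps them at a definite distance from [f p]. *)
Lemma linear_dilatation_le (f g : sphere R -> sphere R) (p : sphere R) (H rho : R) :
  continuous f -> continuous g -> cancel f g -> 1 <= H -> 0 < rho ->
  (forall q q', chordal p q <= chordal p q' -> chordal p q' < rho ->
    chordal (f p) (f q) <= H * chordal (f p) (f q')) ->
  (linear_dilatation f p <= H%:E)%E.
Proof.
move=> fc gc fgK H1 rho0 hloc.
have [m m0 hm] : exists2 m : R, 0 < m &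
    forall x : sphere R, chordal (f p) x < m -> chordal p (g x) < rho.
  apply: (@chordal_nbhs (f p) [set x : sphere R | chordal p (g x) < rho]).
  have hA : nbhs (g (f p)) [set y : sphere R | chordal p y < rho].
    by rewrite fgK; exact: nbhs_chordal.
  exact: (gc (f p) _ hA).
have [r0 r00 hr0] : exists2 r0 : R, 0 < r0 &
    forall q, chordal p q < r0 -> chordal (f p) (f q) < m.
  apply: (@chordal_nbhs p [set q : sphere R | chordal (f p) (f q) < m]).
  exact: (fc p _ (@nbhs_chordal (f p) m m0)).
have key r q q' : r < r0 -> chordal p q <= r -> r <= chordal p q' ->
    chordal (f p) (f q) <= H * chordal (f p) (f q').
  move=> rr0 qr rq'.
  have [/hloc|far] := ltP (chordal p q') rho; first by apply; exact: le_trans rq'.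
  have h1 : m <= chordal (f p) (f q').
    by rewrite leNgt; apply/negP => /hm; rewrite fgK ltNge far.
  have h2 := hr0 q (le_lt_trans qr rr0).
  by have := chordal_ge0 (f p) (f q'); nra.
have bound r : 0 < r -> r < r0 -> outer_radius f p r / inner_radius f p r <= H.
  move=> rp rr0.
  set O := [set chordal (f p) (f q) | q in [set q | chordal p q <= r]].
  set I := [set chordal (f p) (f q) | q in [set q | r <= chordal p q]].
  (* If no point is at distance [r] or more, the infimum is 0 by default, and so is the quotient. *)
  have [I0|/nonemptyPn nI] := pselect (I !=set0); last first.
    have -> : inner_radius f p r = 0.
      by rewrite /inner_radius -/I nI inf0.
    by rewrite invr0 mulr0; lra.
  have infge0 : 0 <= inner_radius f p r.
    by apply: lb_le_inf => // _ [q _ <-]; exact: chordal_ge0.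
  have O0 : O !=set0.
    by exists (chordal (f p) (f p)), p => //=; rewrite chordal_self ltW.
  have OI : outer_radius f p r <= H * inner_radius f p r.
    rewrite -ler_pdivrMl; last lra.
    apply: lb_le_inf => // _ [q' hq' <-]; rewrite ler_pdivrMl; last lra.
    by apply: ge_sup => // _ [q hq <-]; exact: (key r).
  move: infge0; rewrite le_eqVlt => /orP[/eqP <-|i0].
    by rewrite invr0 mulr0; lra.
  by rewrite ler_pdivrMr.
rewrite /linear_dilatation limf_esupE.
apply: (@le_trans _ _ (ereal_sup
  ((fun r : R => (outer_radius f p r / inner_radius f p r)%:E) @` [set r | 0 < r < r0]))).
  apply: ereal_inf_lbound; exists [set r | 0 < r < r0] => //.
  near=> r; apply/andP; split; near: r; first exact: nbhs_right_gt.
  exact: nbhs_right_lt.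
by apply: ge_ereal_sup => _ [r /andP[h1 h2] <-]; rewrite lee_fin bound.
Unshelve. all: by end_near. Qed.

Definition smap (f : Cplx R -> Cplx R) (p : sphere R) : sphere R :=
  if p is Some z then Some (f z) else None.

Lemma continuous_smap (f : Cplx R -> Cplx R) (M : R) : continuous f ->
  (forall z, M <= normc z -> f z = z) -> continuous (smap f).
Proof.
move=> fc fM [z|] A; first by move=> hA; exact: (fc z _ hA).
move=> [K [cK clK] hK]; exists (K `|` cball M).
  by split; [apply: compactU => //; exact: compact_cball|
             apply: closedU => //; exact: closed_cball].
move=> [x|] /=; last by move=> _; apply: hK; right.
case=> [[y hy [<-]]|//]; apply: hK; left.
have [hy1 hy2] : ~ K y /\ ~ (normc y <= M) by split => ?; apply: hy; [left|right].
by exists y => //; rewrite fM // leNgt; apply/negP => /ltW.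
Qed.

Lemma nbhs_None_fix (f : Cplx R -> Cplx R) (M : R) :
  (forall z, M <= normc z -> f z = z) ->
  nbhs (None : sphere R) [set q | smap f q = q].
Proof.
move=> fM; exists (cball M); first by split; [exact: compact_cball|exact: closed_cball].
move=> [x|] //= [[y hy [<-]]|//]; rewrite fM //.
by rewrite leNgt; apply/negP => /ltW.
Qed.

Lemma linear_dilatation_fix (f g : sphere R -> sphere R) (p : sphere R) (H : R) :
  continuous f -> continuous g -> cancel f g -> 1 <= H ->
  nbhs p [set q | f q = q] -> (linear_dilatation f p <= H%:E)%E.
Proof.
move=> fc gc fgK H1 fp; have [rho rho0 hrho] := chordal_nbhs fp.
apply: (linear_dilatation_le fc gc fgK H1 rho0) => q q' h h'.
rewrite (hrho q' h') (hrho q (le_lt_trans h h')) hrho ?chordal_self //.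
by have := chordal_ge0 p q'; nra.
Qed.

End Chordal.

(** * Descending to the plane *)

Definition clog (R : realType) (z : R[i]) : R[i] := xget 0 [set w | cexp w = z].

Lemma clogK (R : realType) (z : R[i]) : z != 0 -> cexp (clog z) = z.
Proof.
by move=> /cexp_surj h; exact: (@xgetPex _ 0 [set w | cexp w = z] h).
Qed.

(** What lets a map of the logarithmic coordinate descend to a continuous map of the plane: [lm_per]
    makes it independent of the choice of logarithm, and [lm_far] makes it the identity near 0 and
    infinity, the two points that [cexp] misses. *)
Record log_map (R : realType) (P : R[i] -> R[i]) : Prop := LogMap {
  lm_per : forall y tau, cexp tau = 1 -> P (y + tau) = P y + tau;
  lm_cont : forall eta : R, 0 < eta -> exists2 r : R, 0 < r &
    forall y1 y2, normc (y1 - y2) < r -> normc (P y1 - P y2) < eta;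
  lm_far : forall y, 2 <= `|Re y| -> P y = y }.

Definition lift (R : realType) (P : R[i] -> R[i]) (z : Cplx R) : Cplx R :=
  if z == 0 then 0 else cexp (P (clog z)).

Section Lift.
Variables (R : realType) (P : R[i] -> R[i]).
Hypothesis hP : log_map P.

Lemma lift0 : lift P 0 = 0. Proof. by rewrite /lift eqxx. Qed.

Lemma lift_cexp y : lift P (cexp y) = cexp (P y).
Proof.
have z0 := cexp_neq0 y; rewrite /lift (negbTE z0).
set v := clog (cexp y); have hv : cexp (v - y) = 1.
  by rewrite cexpB clogK // mulfV.
have -> : v = y + (v - y) by rewrite addrC subrK.
by rewrite (lm_per hP _ hv) cexpD hv mulr1.
Qed.

Lemma lift_far z : expR 2 <= normc z \/ normc z <= expR (- 2) -> lift P z = z.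
Proof.
have [->|/cexp_surj[y <-]] := eqVneq z 0; first by rewrite lift0.
rewrite normc_cexp !ler_expR lift_cexp => h; rewrite (lm_far hP) //.
by rewrite ler_normr; apply/orP; case: h => ?; [left|right]; lra.
Qed.

Lemma cexp_chart (y x : R[i]) : normc ((x - cexp y) / cexp y) <= 1 / 32 ->
  exists h, [/\ x = cexp (y + h), normc h <= 2 * normc ((x - cexp y) / cexp y) &
    normc ((x - cexp y) / cexp y) <= 2 * normc h].
Proof.
move=> u; have [h [h1 h2]] := clog_near1 u; have z0 := cexp_neq0 y.
have h8 : normc h <= 1 / 8 by lra.
exists h; split => //; first by rewrite cexpD h2 mulrDr mulr1 mulrC divfK // addrC subrK.
have /andP[_] := cexpB1_bounds h8.
by rewrite h2 [1 + _]addrC addrK.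
Qed.

Lemma lift_cont (z : Cplx R) (eta : R) : 0 < eta -> exists2 r : R, 0 < r &
  forall x, normc (z - x) < r -> normc (lift P z - lift P x) < eta.
Proof.
move=> eta0; have [->|/cexp_surj[y <-]] := eqVneq z 0.
  exists (Num.min eta (expR (- 2))); first by rewrite lt_min eta0 expR_gt0.
  move=> x; rewrite sub0r normcNE lt_min => /andP[h1 h2].
  by rewrite lift0 lift_far ?sub0r ?normcNE //; right; exact: ltW.
set E := normc (cexp (P y)).
have E0 : 0 < E by rewrite normc_gt0 cexp_neq0.
have m0 : 0 < Num.min (1 / 8) (eta / (2 * E)).
  by rewrite lt_min !divr_gt0 ?mulr_gt0.
have [r1 r10 hr1] := lm_cont hP m0.
set N := normc (cexp y); have N0 : 0 < N by rewrite normc_gt0 cexp_neq0.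
exists (N * Num.min (1 / 32) (r1 / 2)).
  by rewrite mulr_gt0 // lt_min !divr_gt0.
move=> x; rewrite -ltr_pdivrMl // mulrC lt_min normcBC => /andP[h1 h2].
have u : normc ((x - cexp y) / cexp y) = normc (x - cexp y) / N by rewrite normcM normcV.
have [|h [xh k1 k2]] := @cexp_chart y x; first by rewrite u ltW.
rewrite xh !lift_cexp.
have hk : normc (P (y + h) - P y) < Num.min (1 / 8) (eta / (2 * E)).
  by apply: hr1; rewrite addrC addKr; rewrite u in k1; lra.
move: hk; set k := P (y + h) - P y; rewrite lt_min => /andP[/ltW k8 ke].
have -> : P (y + h) = P y + k by rewrite /k addrCA subrr addr0.
have -> : cexp (P y) - cexp (P y + k) = - (cexp (P y) * (cexp k - 1)).
  by rewrite cexpD mulrBr mulr1 opprB.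
rewrite normcNE normcM -/E; have /andP[_ b] := cexpB1_bounds k8.
move: ke; rewrite ltr_pdivlMr ?mulr_gt0 //; nra.
Qed.

Lemma continuous_lift : continuous (lift P).
Proof.
move=> z A /nbhs_CplxP [eta eta0 hA]; have [r r0 hr] := lift_cont z eta0.
by apply/nbhs_CplxP; exists r => // x /hr; exact: hA.
Qed.

End Lift.

Lemma lift_cancel (R : realType) (P Q : R[i] -> R[i]) :
  log_map P -> log_map Q -> cancel P Q -> cancel (lift P) (lift Q).
Proof.
move=> hP hQ PQ z; have [->|/cexp_surj[y <-]] := eqVneq z 0; first by rewrite !lift0.
by rewrite !lift_cexp // PQ.
Qed.

Section ShadowLogMap.
Variables (R : realType) (delta : R) (e : R[i] -> R[i]).
Hypothesis delta_small : delta <= 1 / (100 * 100).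
Hypothesis he : admissible delta e.

Let delta8 : delta <= 1 / 8. Proof. by have := delta_small; lra. Qed.

Lemma log_map_Psi : log_map (Psi e).
Proof.
split.
- move=> y tau ht; apply: (shadow_unique_source delta8 he (PsiP delta8 _ he)).
  exact: (shadow_period he ht (PsiP delta8 _ he)).
- move=> eta eta0; have [r r0 hr] := Psi_uniform_cont delta_small he eta0.
  exists r => // y1 y2 h.
  exact: (hr _ _ _ _ (PsiP delta8 _ he) (PsiP delta8 _ he) h).
- move=> y hy; apply: (shadow_unique_source delta8 he (PsiP delta8 _ he)).
  exact: (shadow_far he).
Qed.

Lemma log_map_Phi : log_map (Phi e).
Proof.
split.
- move=> w tau ht; apply: (shadow_unique_target (PhiP _ he)).
  exact: (shadow_period he ht (PhiP _ he)).
- move=> eta eta0; have [r r0 hr] := Phi_uniform_cont delta_small he eta0.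
  exists r => // w1 w2 h.
  exact: (hr _ _ _ _ (PhiP _ he) (PhiP _ he) h).
- move=> w hw; apply: (shadow_unique_target (PhiP _ he)).
  exact: (shadow_far he).
Qed.

(** Pulling back through the chart turns the factor 3 into 12, within the 32 allowed by
    [quasisymmetry]; its factor 200, doubled on each side by the exponential, gives 800. *)
Lemma lift_Psi_quasisymmetric (z : Cplx R) : z != 0 -> exists2 t : R, 0 < t &
  forall x x', normc (z - x) < t -> normc (z - x') < t ->
    normc (z - x) <= 3 * normc (z - x') ->
    normc (lift (Psi e) z - lift (Psi e) x) <=
      800 * normc (lift (Psi e) z - lift (Psi e) x').
Proof.
move=> /cexp_surj[y <-]; set P := Psi e.
have hP : log_map P := log_map_Psi.
have e8 : 0 < 1 / 8 :> R by [].
have [r1 r10 hr1] := lm_cont hP e8.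
set N := normc (cexp y); have N0 : 0 < N by rewrite normc_gt0 cexp_neq0.
exists (N * Num.min (1 / 32) (r1 / 2)).
  by rewrite mulr_gt0 // lt_min !divr_gt0.
have chart x : normc (cexp y - x) < N * Num.min (1 / 32) (r1 / 2) ->
    exists h, [/\ x = cexp (y + h),
      normc h * N <= 2 * normc (cexp y - x),
      normc (cexp y - x) <= 2 * (normc h * N) &
      normc (P (y + h) - P y) <= 1 / 8].
  rewrite -ltr_pdivrMl // mulrC lt_min normcBC => /andP[h1 h2].
  have u : normc ((x - cexp y) / cexp y) = normc (x - cexp y) / N by rewrite normcM normcV.
  have [|h [xh k1 k2]] := @cexp_chart R y x; first by rewrite u ltW.
  exists h; split=> //.
  - by move: k1; rewrite u mulrA ler_pdivlMr.
  - by move: k2; rewrite u ler_pdivrMr // mulrA.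
  - by apply: ltW; apply: hr1; rewrite addrC addKr; rewrite u in k1; lra.
move=> x x' /chart[h [-> a1 a2 a3]] /chart[h' [-> b1 b2 b3]] hxx.
rewrite !lift_cexp //.
have E k : cexp (P y) - cexp (P (y + k)) = - (cexp (P y) * (cexp (P (y + k) - P y) - 1)).
  by rewrite cexpB mulrBr mulr1 mulrCA mulfV ?cexp_neq0 // mulr1 opprB.
rewrite !E !normcNE !(normcM (cexp (P y))) mulrCA ler_wpM2l ?normc_ge0 //.
have hh : normc (y - (y + h)) <= 32 * normc (y - (y + h')).
  rewrite !opprD !addNKr !normcNE.
  rewrite -(ler_pM2r N0); have := normc_ge0 h'; lra.
have PS v : shadow e (P v) v := PsiP delta8 v he.
have a4 : normc (P y - P (y + h)) <= 1 / 4 by rewrite normcBC; lra.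
have := quasisymmetry delta_small he (PS y) (PS (y + h)) (PS (y + h')) a4 hh.
rewrite !(normcBC (P y)) => qs.
have /andP[_ c1] := cexpB1_bounds a3; have /andP[c2 _] := cexpB1_bounds b3.
lra.
Qed.

End ShadowLogMap.

(* Near [z] the chordal metric is proportional to the Euclidean one up to a
   factor 3; this turns the factor 800 into 2400. *)
Lemma linear_dilatation_smap (R : realType) (f : Cplx R -> Cplx R)
    (g : sphere R -> sphere R) (z : Cplx R) (t : R) :
  continuous f -> continuous (smap f) -> continuous g -> cancel (smap f) g ->
  0 < t ->
  (forall x x', normc (z - x) < t -> normc (z - x') < t ->
    normc (z - x) <= 3 * normc (z - x') ->
    normc (f z - f x) <= 800 * normc (f z - f x')) ->
  (linear_dilatation (smap f) (Some z) <= (3 * 800)%:E)%E.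
Proof.
move=> fc sfc gc fgK t0 hf.
have /nbhs_CplxP[r1 r10 hr1] : nbhs z [set x | normc (f z - f x) < 1 / 2].
  have hA : nbhs (f z) [set u : Cplx R | normc (f z - u) < 1 / 2].
    by apply/nbhs_CplxP; exists (1 / 2).
  exact: (fc z _ hA).
pose t1 := Num.min (1 / 2) (Num.min t r1).
have t10 : 0 < t1 by rewrite !lt_min t0 r10 !andbT.
have [rho rho0 hrho] : exists2 rho : R, 0 < rho &
    forall q, chordal (Some z) q < rho -> exists2 x, q = Some x & normc (z - x) < t1.
  apply: (@chordal_nbhs R (Some z) [set q | exists2 x, q = Some x & normc (z - x) < t1]).
  apply/nbhs_CplxP; exists t1 => // x hx; by exists x.
apply: (linear_dilatation_le sfc gc fgK _ rho0); first lra.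
move=> q q' h h'; have [x qx] := hrho q (le_lt_trans h h').
have [x' qx'] := hrho q' h'; rewrite {}qx {}qx' in h *.
rewrite !lt_min => /and3P[/ltW x1 x2 /hr1 /ltW x3] /and3P[/ltW y1 y2 /hr1 /ltW y3].
have /andP[a1 a2] := chordal_close y1; have /andP[a3 a4] := chordal_close y3.
have /andP[b1 b2] := chordal_close x1; have /andP[b3 b4] := chordal_close x3.
have j0 : 0 < (jap z ^+ 2)^-1 by rewrite invr_gt0 exprn_gt0 // jap_gt0.
have j1 : 0 < (jap (f z) ^+ 2)^-1 by rewrite invr_gt0 exprn_gt0 // jap_gt0.
have hx : normc (z - x) <= 3 * normc (z - x').
  by rewrite -(ler_pM2r j0); lra.
have := ler_wpM2r (ltW j1) (hf x x' y2 x2 hx).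
rewrite /=; rewrite /= in b3 a4; lra.
Qed.

(** * The filled set as a quasiconformal image of the disk *)

Section QuasiDisk.
Variables (R : realType) (c : Cplx R) (delta : R).
Hypothesis c_small : normc c <= (32 * expR 2)^-1.
Hypothesis delta_small : delta <= 1 / (100 * 100).
Hypothesis adm : admissible delta (eps c).

Let delta8 : delta <= 1 / 8. Proof. by have := delta_small; lra. Qed.

Local Notation f := (lift (Psi (eps c))).
Local Notation g := (lift (Phi (eps c))).

Lemma lift_Psi_disk : f @` [set z | normc z <= 1] = Kdiag c.
Proof.
have fP : log_map (Psi (eps c)) := log_map_Psi delta_small adm.
apply/seteqP; split=> [_ [z z1 <-]|z Kz].
  have [->|] := eqVneq z 0; first by rewrite lift0; exact: (Kdiag0 c_small).
  move=> /cexp_surj[y yz]; rewrite /= -yz in z1 *.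
  rewrite normc_cexp -expR0 ler_expR in z1.
  by rewrite lift_cexp //; apply/(Kdiag_cexp c_small delta_small adm (PsiP delta8 y adm)).
have [->|] := eqVneq z 0.
  have n0 : normc (0 : R[i]) <= 1 by rewrite normc0.
  by exists 0 => //; exact: lift0.
move=> /cexp_surj[w wz]; rewrite -wz in Kz *.
have /(Kdiag_cexp c_small delta_small adm (PhiP w adm)) y0 := Kz.
have w1 : normc (cexp (Phi (eps c) w)) <= 1 by rewrite normc_cexp -expR0 ler_expR.
exists (cexp (Phi (eps c) w)) => //.
by rewrite lift_cexp // (PhiK delta8 adm).
Qed.

Lemma quasi_disk_Kdiag : quasi_disk (Kdiag c).
Proof.
have fP : log_map (Psi (eps c)) := log_map_Psi delta_small adm.
have gP : log_map (Phi (eps c)) := log_map_Phi delta_small adm.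
have fg : cancel f g := lift_cancel fP gP (PsiK delta8 adm).
have gf : cancel g f := lift_cancel gP fP (PhiK delta8 adm).
have ffar z : expR 2 <= normc z -> f z = z by move=> h; apply: lift_far => //; left.
have gfar z : expR 2 <= normc z -> g z = z by move=> h; apply: lift_far => //; left.
have sfc : continuous (smap f) := continuous_smap (continuous_lift fP) ffar.
have sgc : continuous (smap g) := continuous_smap (continuous_lift gP) gfar.
have sfg : cancel (smap f) (smap g) by case=> [z|] //=; rewrite fg.
have sgf : cancel (smap g) (smap f) by case=> [z|] //=; rewrite gf.
have H1 : 1 <= 3 * 800 :> R by lra.
exists (smap f); split; last first.
  rewrite -lift_Psi_disk; apply/seteqP; split=> [_ [_ [z z1 <-] <-]|_ [_ [z z1 <-] <-]].
    by exists (f z) => //; exists z.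
  by exists (Some z) => //; exists z.
split; first by split=> //; exists (smap g).
exists (3 * 800) => -[z|]; last first.
  exact: (linear_dilatation_fix sfc sgc sfg H1 (nbhs_None_fix ffar)).
(* The logarithmic chart misses 0 as it misses infinity; there the map is locally the identity. *)
have [->|z0] := eqVneq z 0.
  apply: (linear_dilatation_fix sfc sgc sfg H1).
  apply/nbhs_CplxP; exists (expR (- 2)); first exact: expR_gt0.
  move=> x; rewrite sub0r normcNE => /ltW hx.
  by rewrite /= lift_far //; right.
have [t t0 ht] := lift_Psi_quasisymmetric delta_small adm z0.
exact: (linear_dilatation_smap (continuous_lift fP) sfc sgc sfg t0 ht).
Qed.

Lemma compact_Kdiag : compact (Kdiag c).
Proof.
have fP : log_map (Psi (eps c)) := log_map_Psi delta_small adm.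
rewrite -lift_Psi_disk.
exact: continuous_compact (continuous_subspaceT (continuous_lift fP)) (@compact_cball R 1).
Qed.

End QuasiDisk.

(** * Dependence on the parameter *)

Lemma hausdorff_dist_le (R : realType) (A B : set (Cplx R)) (b : R) :
  A !=set0 -> B !=set0 ->
  (forall x, A x -> exists2 y, B y & normc (x - y) <= b) ->
  (forall y, B y -> exists2 x, A x & normc (y - x) <= b) ->
  0 <= hausdorff_dist A B <= b.
Proof.
have excess (A' B' : set (Cplx R)) : A' !=set0 -> B' !=set0 ->
    (forall x, A' x -> exists2 y, B' y & normc (x - y) <= b) ->
    0 <= hausdorff_excess A' B' <= b.
  move=> [x0 Ax0] [y0 By0] h; rewrite /hausdorff_excess.
  set S := [set _ | _ in A'].
  have ge0 x : 0 <= inf [set normc (x - y) | y in B'].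
    apply: lb_le_inf; first by exists (normc (x - y0)), y0.
    by move=> _ [y _ <-]; exact: normc_ge0.
  have leb : ubound S b.
    move=> _ [x Ax <-]; have [y By xy] := h x Ax; apply: le_trans xy.
    by apply: ge_inf; [exists 0 => _ [y' _ <-]; exact: normc_ge0|exists y].
  apply/andP; split; last by apply: ge_sup => //; exists (inf [set normc (x0 - y) | y in B']), x0.
  apply: (le_trans (ge0 x0)); apply: ub_le_sup; first by exists b.
  by exists x0.
move=> A0 B0 hA hB; rewrite /hausdorff_dist.
have /andP[a1 a2] := excess A B A0 B0 hA; have /andP[b1 b2] := excess B A B0 A0 hB.
by rewrite le_max a1 /= ge_max a2 b2.
Qed.

(** The point with the same shadow is the comparison point. [shadow_diff] and [eps_param] give 4
    times 4 expR 2, the exponential doubles this, and expR 1 bounds the modulus of the new point,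
    whose logarithm has real part at most 2 delta. *)
Lemma Kdiag_excess (R : realType) (c c' : Cplx R) (delta : R) :
  delta <= 1 / (100 * 100) ->
  normc c <= (32 * expR 2)^-1 -> normc c' <= (32 * expR 2)^-1 ->
  admissible delta (eps c) -> admissible delta (eps c') ->
  16 * expR 2 * normc (c - c') <= 1 / 8 ->
  forall z, Kdiag c z -> exists2 z', Kdiag c' z' &
    normc (z - z') <= expR 1 * (32 * expR 2) * normc (c - c').
Proof.
move=> ds hc hc' adm adm' cc z.
have d8 : delta <= 1 / 8 by lra.
have K0 := expR_gt0 (2 : R); have L0 := expR_gt0 (1 : R).
have n0 := normc_ge0 (c - c').
have [->|/cexp_surj[w <-]] := eqVneq z 0 => Kz.
  exists 0; first exact: (Kdiag0 hc').
  by rewrite subrr normc0 mulr_ge0 // mulr_ge0 ?expR_ge0 // mulr_ge0 ?expR_ge0.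
pose y := Phi (eps c) w; have sw : shadow (eps c) w y := PhiP w adm.
have y0 : Re y <= 0 by apply/(Kdiag_cexp hc ds adm sw).
pose w' := Psi (eps c') y; have sw' : shadow (eps c') w' y := PsiP d8 y adm'.
exists (cexp w'); first by apply/(Kdiag_cexp hc' ds adm' sw').
have ww := shadow_diff d8 adm adm' (fun s => eps_param s hc hc') sw sw'.
have w8 : normc (w - w') <= 1 / 8 by lra.
have -> : cexp w - cexp w' = cexp w' * (cexp (w - w') - 1).
  by rewrite cexpB mulrBr mulr1 mulrCA mulfV ?cexp_neq0 // mulr1.
have /andP[_ b] := cexpB1_bounds w8.
have e1 : normc (cexp w') <= expR 1.
  rewrite normc_cexp ler_expR; have := shadow_bound adm' sw' 0; rewrite mul1r => h.
  have := le_trans (ler_normRe _) h; rewrite ReB ler_norml => /andP[_].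
  by rewrite /=; lra.
rewrite normcM -mulrA ler_pM ?normc_ge0 //; lra.
Qed.

Theorem theorem5p1 (R : realType) :
  exists2 a : R, 0 < a &
    (forall c : Cplx R, normc c < a -> quasi_disk (Kdiag c)) /\
    hausdorff_continuous_on [set c : Cplx R | normc c < a] (@Kdiag R).
Proof.
pose K := expR (2 : R); have K0 : 0 < K := expR_gt0 _.
pose d : R := 1 / (100 * 100); have d0 : 0 < d by rewrite /d; lra.
have dd : d <= 1 / (100 * 100) by exact: lexx.
(* 66 K a = d makes [eps c] admissible with constant [d]; as d <= 1, it also gives |c| <= 1 / (32
   K). *)
pose a := d / (66 * K); have a0 : 0 < a by rewrite divr_gt0 // mulr_gt0.
have adm c : normc c < a -> normc c <= (32 * K)^-1 /\ admissible d (eps c).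
  move=> /ltW ca; have hd : 66 * K * normc c <= d.
    by move: ca; rewrite /a ler_pdivlMr ?mulr_gt0 // mulrC.
  have hc : normc c <= (32 * K)^-1.
    rewrite -div1r ler_pdivlMr ?mulr_gt0 //.
    have : d <= 1 by rewrite /d; lra.
    have := mulr_ge0 (ltW K0) (normc_ge0 c); lra.
  by split=> //; exact: eps_admissible.
exists a => //; split=> [c /adm[hc ac]|].
  exact: (quasi_disk_Kdiag hc dd ac).
split=> [c /adm[hc ac]|c ca].
  by split; [exists 0; exact: (Kdiag0 hc)|exact: (compact_Kdiag hc dd ac)].
have [hc ac] := adm c ca.
apply/cvgrPdist_le => /= eta eta0.
pose C := expR 1 * (32 * K); have C0 : 0 < C by rewrite !mulr_gt0 ?expR_gt0.
apply/nbhs_CplxP; exists (Num.min (1 / 8 / (16 * K)) (eta / C)).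
  by rewrite lt_min !divr_gt0 // mulr_gt0.
move=> x; rewrite lt_min => /andP[/ltW h1 /ltW h2] xa.
have [hx ax] := adm x xa.
rewrite ler_pdivlMr ?mulr_gt0 // mulrC in h1; rewrite ler_pdivlMr // mulrC in h2.
have h1' : 16 * K * normc (x - c) <= 1 / 8 by rewrite normcBC.
have h2' : C * normc (x - c) <= eta by rewrite normcBC.
have /andP[p1 p2] : 0 <= hausdorff_dist (Kdiag x) (Kdiag c) <= eta.
  apply: hausdorff_dist_le.
  - by exists 0; exact: (Kdiag0 hx).
  - by exists 0; exact: (Kdiag0 hc).
  - move=> z /(Kdiag_excess dd hx hc ax ac h1')[z' Kz' zz'].
    by exists z' => //; exact: le_trans zz' h2'.
  - move=> z /(Kdiag_excess dd hc hx ac ax h1)[z' Kz' zz'].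
    by exists z' => //; exact: le_trans zz' h2.
by rewrite sub0r normrN ger0_norm.
Qed.
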